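(* Let $q>1$ and let $m_1<m_2<\cdots$ be positive integers with $\frac{m_{k+1}}{m_k}\ge q$ for all $k\in\mathbb{N}$. Let $(a_{k,n})_{1\le k\le n}$ be a triangular array of real numbers, and put $$S_n^{\mathrm T}(x)=\sum_{k=1}^n a_{k,n}\cos(2\pi m_k x),\quad 0\le x\le 1,\qquad A_n=\Big(\tfrac12\sum_{k=1}^n a_{k,n}^2\Big)^{1/2},\qquad d_n=\max_{1\le k\le n}|a_{k,n}|.$$ Suppose $A_n\to\infty$ as $n\to\infty$, and suppose that there exists $\varepsilon>0$ such that, as $n\to\infty$, - if $1<q\le 2$: $n^{1+\varepsilon}d_n^3\to 0$; - if $q>2$: $n^{1+\varepsilon}d_n^4\to 0$. Then for every bounded Jordan measurable set $B\subset\mathbb{R}$, $$A_n\,\big|\{x\in[0,1]:\ S_n^{\mathrm T}(x)\in B\}\big|\ \longrightarrow\ \frac{1}{\sqrt{2\pi}}\,|B|\qquad(n\to\infty).$$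
   Context: $|\cdot|$ of a set denotes Lebesgue measure. *)

(* Defs.v *)
From mathcomp Require Import all_boot all_order all_algebra.
From mathcomp Require Import all_classical all_reals all_analysis.

Set Implicit Arguments.
Unset Strict Implicit.
Unset Printing Implicit Defensive.

Import Order.TTheory GRing.Theory Num.Theory.
Import numFieldNormedType.Exports.

Local Open Scope classical_set_scope.
Local Open Scope ring_scope.

(* Lebesgue measure on R. It is the completed measure, because a Jordan
   measurable set need not be Borel. Outside the Lebesgue measurable sets the
   underlying function takes the value of the outer measure. *)
Definition leb (R : realType) (A : set R) : \bar R :=
  @completed_lebesgue_measure R A.

(* Finite unions of bounded intervals, each endpoint included or not. *)
Definition elementary_set (R : realType) (E : set R) : Prop :=
  exists s : seq (interval R),
    (forall i, i \in s -> bounded_set [set` i]) /\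
    E = [set x | exists2 i, i \in s & x \in i].

Definition inner_jordan_content (R : realType) (B : set R) : \bar R :=
  ereal_sup [set leb E | E in [set E | elementary_set E /\ E `<=` B]].

Definition outer_jordan_content (R : realType) (B : set R) : \bar R :=
  ereal_inf [set leb E | E in [set E | elementary_set E /\ B `<=` E]].

Definition bounded_jordan_measurable (R : realType) (B : set R) : Prop :=
  bounded_set B /\ inner_jordan_content B = outer_jordan_content B.

(* The sequence m_k and the array a_{k,n} are indexed from k = 1, n = 1; values
   at index 0 and a k n for n < k are never used. *)

Definition trig_sum (R : realType) (m : nat -> nat) (a : nat -> nat -> R)
    (n : nat) (x : R) : R :=
  \sum_(1 <= k < n.+1) a k n * cos (2 * pi * (m k)%:R * x).

Definition array_norm (R : realType) (a : nat -> nat -> R) (n : nat) : R :=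
  Num.sqrt (2^-1 * \sum_(1 <= k < n.+1) a k n ^+ 2).

Definition array_max (R : realType) (a : nat -> nat -> R) (n : nat) : R :=
  \big[Num.max/0]_(1 <= k < n.+1) `|a k n|.

(* Main.v *)
Require Import Defs.
From mathcomp Require Import all_boot all_order all_algebra.
From mathcomp Require Import all_classical all_reals all_analysis.
From mathcomp Require Import measurable_realfun.
From mathcomp Require Import ring lra.

Set Implicit Arguments.
Unset Strict Implicit.
Unset Printing Implicit Defensive.

Import Order.TTheory GRing.Theory Num.Theory.
Import numFieldNormedType.Exports.

Local Open Scope classical_set_scope.
Local Open Scope ring_scope.

(** The theorem is a local limit theorem: the values of the trigonometric sum
    S_n spread over a window of width A_n, and inside that window they have the
    Gaussian density at the origin.  It holds because the characteristic
    function lambda_n(t), the mean over [0, 1] of e^(i t S_n), is Gaussian not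
    only near t = 0 but uniformly on every bounded range of t.

    Fix t, put b_k = t a_(k,n) and let h bound all |b_k|.  Each factor of
    e^(i t S_n) is replaced by its Taylor polynomial of degree 5 in
    b_k cos(2 pi m_k x); this costs O(n h^6) in all and turns the product into a
    trigonometric polynomial whose Fourier coefficients obey a one-step
    recursion (fcoef).  The k-th factor has middle coefficient
    (1 - b_k^2/8)^2, which is 1 - b_k^2/4 up to O(h^4), and couples a frequency
    nu to nu +- l m_k with weight at most h^l.  By lacunarity a frequency of
    size about (r - 1) m_k or more can be reached only by spending at least r
    factors h (fcoef_far).  Hence, near a small frequency, one step of the
    recursion is multiplication by 1 - b_k^2/4 with relative error O(h^g), where
    g is the length of the shortest possible resonance: g = 3 if q <= 2 (three
    frequencies can cancel, as in m_(k+1) = 2 m_k) and g = 4 if q > 2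
    (fcoef_near).  The bound must be propagated for all frequencies at once, and
    it is: a frequency that is not small is already damped by a factor h.  As
    n h^g tends to 0, the mean of the product is the product of the
    1 - b_k^2/4, that is, e^(-t^2 A_n^2/2) up to a bounded factor, uniformly for
    bounded t, and up to a factor tending to 1 at t = s/A_n
    (trig_sum_char_dominated, trig_sum_char_limit).

    The passage to sets uses the Fejer kernel, whose Fourier transform has
    compact support, so that only bounded t matter.  Writing A_n times the mean
    of fejer (T (S_n - y)) as an integral of lambda_n(s/A_n) over
    0 <= s <= T A_n, dominated convergence gives the limit sqrt(2 pi) / T
    (fejer_average_cvg).  Averaging over y in [a, b] replaces the kernel by a
    smoothed indicator of [a, b] (smoothed_indicator_average_cvg).  Its distance
    to the true indicator is itself bounded by Fejer kernels: narrow ones at a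
    and b, and broad ones with weight O(1/T) (smoothed_indicator_error).  The
    same limit bounds their means, which yields the theorem for intervals
    (occupation_interval_cvg); inclusion-exclusion gives finite unions of
    intervals, and monotonicity gives Jordan measurable sets
    (jordan_occupation_cvg). *)

(** * Fourier coefficients of lacunary products *)

Section FourierCoefficients.
Context (R : realType).
Implicit Types (b h phi nu mu : R).

(** The even coefficients give the real part and the odd ones the imaginary part
    of the Taylor polynomial of degree 5 of e^(i y) at y = b cos theta, as sums
    of factor_coef b l times 2 cos (l theta), with the plain factor_coef b 0 as
    constant term.  The degree is 5 because the truncation error of n factors,
    of order n h^6, has to be small even after multiplication by A_n^2, which is
    at most n h^2. *)
Definition factor_coef b (l : nat) : R :=
  match l with
  | 0 => (1 - b ^+ 2 / 8) ^+ 2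
  | 1 => b / 2 - b ^+ 3 / 16 + b ^+ 5 / 384
  | 2 => - (b ^+ 2 / 8) + b ^+ 4 / 96
  | 3 => - (b ^+ 3 / 48) + b ^+ 5 / 768
  | 4 => b ^+ 4 / 384
  | 5 => b ^+ 5 / 3840
  | _ => 0
  end.

(** A factor i is recorded as a shift of the phase by pi/2, which keeps the whole
    computation real. *)
Definition phase_shift (l : nat) : R := if odd l then pi / 2 else 0.

(** For the product of the first i factors with frequencies w_1, ..., w_i, this is
    the real part of e^(i phi) times the mean of the product times
    e^(2 pi i nu x).  See integral_phased_prod. *)
Fixpoint fcoef (w b : nat -> R) (i : nat) (nu phi : R) : R :=
  if i is j.+1 then
    factor_coef (b i) 0%N * fcoef w b j nu phi +
    \sum_(1 <= l < 6) factor_coef (b i) l *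
      (fcoef w b j (nu + l%:R * w i) (phi + phase_shift l) +
       fcoef w b j (nu - l%:R * w i) (phi + phase_shift l))
  else if nu == 0 then cos phi else 0.

Lemma factor_coef0_le1 b : `|b| <= 1 -> `|factor_coef b 0%N| <= 1.
Proof.
move=> hb; rewrite /= normrX; apply: exprn_ile1 => //.
have b2 : `|b| ^+ 2 <= 1 by apply: exprn_ile1.
rewrite real_normK ?num_real // in b2.
have b0 := sqr_ge0 b.
by rewrite ler_norml; apply/andP; split; lra.
Qed.

Lemma factor_coef_le b h l : `|b| <= h -> h <= 1 -> (0 < l)%N ->
  `|factor_coef b l| <= h ^+ l.
Proof.
move=> bh h1 l0.
have h0 : 0 <= h by apply: le_trans bh.
suff H : `|factor_coef b l| <= `|b| ^+ l.
  by apply: (le_trans H); rewrite lerXn2r // nnegrE.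
have b1 : `|b| <= 1 by exact: le_trans bh h1.
have b21 : b ^+ 2 <= 1.
  by rewrite -[b ^+ 2]ger0_norm ?sqr_ge0 // normrX exprn_ile1.
have b20 := sqr_ge0 b.
have b4 : b ^+ 4 = (b ^+ 2) ^+ 2 by rewrite -exprM.
have key (c : R) : `|c| <= 1 -> forall k, `|b ^+ k * c| <= `|b| ^+ k.
  by move=> c1 k; rewrite normrM normrX ler_piMr // exprn_ge0.
move: l l0 => [//|[|[|[|[|[|l]]]]]] _ /=.
- rewrite (_ : _ + _ = b ^+ 1 * (1/2 - b ^+ 2 / 16 + (b ^+ 2) ^+ 2 / 384)).
    by apply: key; rewrite ler_norml; apply/andP; split; nra.
  by field.
- rewrite (_ : _ + _ = b ^+ 2 * (- (1/8) + b ^+ 2 / 96)).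
    by apply: key; rewrite ler_norml; apply/andP; split; nra.
  by field.
- rewrite (_ : _ + _ = b ^+ 3 * (- (1/48) + b ^+ 2 / 768)).
    by apply: key; rewrite ler_norml; apply/andP; split; nra.
  by field.
- by apply: key; rewrite ler_norml; apply/andP; split; nra.
- by apply: key; rewrite ler_norml; apply/andP; split; nra.
- by rewrite normr0 exprn_ge0.
Qed.

(** One step of the recursion: B l bounds the coefficients at distance l w_(i+1). *)
Lemma fcoef_step_le (w b : nat -> R) h i nu phi (B : nat -> R) :
  (forall k, `|b k| <= h) -> h <= 1 ->
  (forall l psi, (0 < l)%N -> `|fcoef w b i (nu + l%:R * w i.+1) psi| <= B l) ->
  (forall l psi, (0 < l)%N -> `|fcoef w b i (nu - l%:R * w i.+1) psi| <= B l) ->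
  `|fcoef w b i.+1 nu phi - factor_coef (b i.+1) 0%N * fcoef w b i nu phi| <=
  \sum_(1 <= l < 6) h ^+ l * (2 * B l).
Proof.
move=> hb h1 Bp Bm; rewrite [fcoef _ _ i.+1 _ _]/= addrAC subrr add0r.
apply: (le_trans (ler_norm_sum _ _ _)).
rewrite !big_nat; apply: ler_sum => l /andP[l0 _].
rewrite normrM; apply: ler_pM => //; first exact: factor_coef_le.
rewrite mulr2n mulrDl mul1r; apply: (le_trans (ler_normD _ _)).
by apply: lerD; [exact: Bp|exact: Bm].
Qed.

Section Lacunary.
Context (q theta h : R) (w b : nat -> R) (L : nat).
Hypothesis q1 : 1 < q.
Hypothesis theta0 : 0 < theta.
Hypothesis w0 : w 0%N = 0.
Hypothesis w_gt0 : forall k, 0 < w k.+1.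
Hypothesis w_gap : forall k, q * w k <= w k.+1.
Hypothesis bh : forall k, `|b k| <= h.
Hypothesis h1 : h <= 1.
Hypothesis qL : 5 * q / (q - 1) < theta * q ^+ L.

Local Notation F := (fcoef w b).
Let kappa : R := 20 * 2 ^+ L.
Let D (i : nat) : R := 5 * \sum_(1 <= k < i.+1) w k.

Let h0 : 0 <= h. Proof. exact: le_trans (normr_ge0 _) (bh 0). Qed.

Let w_ge0 k : 0 <= w k.
Proof. by case: k => [|k]; [rewrite w0|apply/ltW]. Qed.

Let w_leS k : w k <= w k.+1.
Proof. by apply: le_trans (w_gap k); rewrite ler_peMl // ltW. Qed.

Let kappa_ge1 : 1 <= kappa.
Proof.
have : 1 <= 2 ^+ L :> R by apply: exprn_ege1; rewrite ler1n.
by rewrite /kappa; lra.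
Qed.

(** The spectrum of the product lies in [- D i, D i], since each factor has degree 5
    in its own frequency. *)
Lemma fcoef_support i nu phi : D i < `|nu| -> F i nu phi = 0.
Proof.
elim: i nu phi => [|i IH] nu phi.
  by rewrite /D big_geq // mulr0 normr_gt0 /= => /negbTE ->.
rewrite /D big_nat_recr //= mulrDr -/(D i) => Hnu.
have far (l : nat) (s : R) psi : (l <= 5)%N -> `|s| = 1 ->
    F i (nu + s * (l%:R * w i.+1)) psi = 0.
  move=> l5 s1; apply: IH.
  have : `|nu| <= `|nu + s * (l%:R * w i.+1)| + `|s * (l%:R * w i.+1)|.
    by rewrite -[X in `|X| <= _](addrK (s * (l%:R * w i.+1))); exact: ler_normB.
  rewrite normrM s1 mul1r normrM (ger0_norm (w_ge0 _)) ger0_norm ?ler0n //.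
  have : l%:R * w i.+1 <= 5 * w i.+1 by rewrite ler_wpM2r // (ler_nat _ l 5).
  by lra.
have -> : F i nu phi = 0.
  by have := far 0%N 1 phi isT (normr1 _); rewrite mul0r mulr0 addr0.
rewrite mulr0 add0r big_nat big1 // => l /andP[l0 l6].
have := far l 1 (phi + phase_shift l) l6 (normr1 _); rewrite mul1r => ->.
have := far l (-1) (phi + phase_shift l) l6; rewrite mulN1r => -> //.
  by rewrite addr0 mulr0.
by rewrite normrN1.
Qed.

Let D_le i : D i <= 5 * q / (q - 1) * w i.
Proof.
have q10 : 0 < q - 1 by rewrite subr_gt0.
elim: i => [|i IH]; first by rewrite /D big_geq // w0 !mulr0.
rewrite /D big_nat_recr //= mulrDr -/(D i).
apply: (@le_trans _ _ (5 * q / (q - 1) * w i + 5 * w i.+1)).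
  by rewrite lerD2r.
have -> : 5 * q / (q - 1) * w i = 5 / (q - 1) * (q * w i) by field; lra.
have : 5 / (q - 1) * (q * w i) <= 5 / (q - 1) * w i.+1.
  by rewrite ler_wpM2l ?divr_ge0 // ltW.
have -> : 5 * q / (q - 1) * w i.+1 = 5 / (q - 1) * w i.+1 + 5 * w i.+1.
  by field; lra.
by lra.
Qed.

Let w_pow j s : q ^+ s * w j <= w (j + s).
Proof.
elim: s => [|s IH]; first by rewrite expr0 mul1r addn0.
rewrite exprS -mulrA addnS; apply: le_trans (w_gap _).
by rewrite ler_wpM2l // ltW // (lt_trans ltr01 q1).
Qed.

Let D_lt i mu : mu != 0 -> theta * w i <= `|mu| -> D (i - L) < `|mu|.
Proof.
move=> mu0 Hmu; have [Li|iL] := ltnP L i; last first.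
  have -> : (i - L = 0)%N by apply/eqP.
  by rewrite /D big_geq // mulr0 normr_gt0.
apply: le_lt_trans (D_le _) _; apply: lt_le_trans Hmu.
have wj : 0 < w (i - L).
  by have := w_gt0 (i - L).-1; rewrite prednK // subn_gt0.
apply: (@lt_le_trans _ _ (theta * q ^+ L * w (i - L))).
  by rewrite ltr_pM2r.
rewrite -mulrA ler_wpM2l //; first exact: ltW.
by apply: le_trans (w_pow _ _) _; rewrite subnK // ltnW.
Qed.

Section Bound.
Context (U : nat -> R).
Hypothesis U0 : forall j, 0 <= U j.
Hypothesis U2 : forall j, U j <= 2 * U j.+1.

Let hpow g l : (0 < l)%N -> (0 < g)%N ->
  h ^+ l * (kappa * h) ^+ (g - l) <= kappa ^+ g.-1 * h ^+ g.
Proof.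
move=> l0 g0; rewrite exprMn mulrCA -exprD.
have k0 : 0 <= kappa by apply: le_trans kappa_ge1.
apply: ler_pM; rewrite ?exprn_ge0 //.
  by apply: ler_weXn2l => //; rewrite -subn1 leq_sub2l.
by apply: ler_wiXn2l => //; rewrite -leq_subLR.
Qed.

Let sum_hpow g (u : R) : (0 < g)%N -> 0 <= u ->
  \sum_(1 <= l < 6) h ^+ l * (2 * ((kappa * h) ^+ (g - l) * u)) <=
  10 * (kappa ^+ g.-1 * h ^+ g) * u.
Proof.
move=> g0 u0.
apply: (@le_trans _ _ (\sum_(1 <= l < 6) 2 * (kappa ^+ g.-1 * h ^+ g) * u)).
  rewrite !big_nat; apply: ler_sum => l /andP[l0 _].
  rewrite mulrCA !mulrA -!mulrA ler_wpM2l // !mulrA.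
  by rewrite ler_wpM2r // hpow.
by rewrite big_const_nat /= !addr0; lra.
Qed.

(** Every factor available costs at least h and moves the frequency by at most
    w_i, so a frequency beyond (g - 1 + theta) w_i is reached only at cost h^g.
    The induction on g spends a factor at the current step; when none is spent
    the frequency stays put while the support shrinks geometrically, so that
    after L steps it has left the support.  The bound is relative to a weight U,
    which may drop by at most half per step; this is where kappa comes from. *)
Lemma fcoef_far g i mu phi :
  (forall j nu psi, (j < i)%N -> `|F j nu psi| <= U j) ->
  (0 < g)%N -> mu != 0 -> (g%:R - 1 + theta) * w i <= `|mu| ->
  `|F i mu phi| <= (kappa * h) ^+ g * U i.
Proof.
have t0 := theta0.
elim/ltn_ind: g i mu phi => g IHg i mu phi HU g0 mu0 Hmu.
have k0 : 0 <= kappa by apply: le_trans kappa_ge1.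
have g1 : 1 <= g%:R :> R by rewrite ler1n.
(* s counts the steps that remain until mu leaves the support. *)
suff H s : D (i - s) < `|mu| ->
    `|F i mu phi| <= (2 ^+ s - 1) * 20 * (kappa ^+ g.-1 * h ^+ g) * U i.
  have DL : D (i - L) < `|mu|.
    apply: D_lt => //; apply: le_trans Hmu.
    by rewrite ler_wpM2r //; lra.
  apply: (le_trans (H L DL)); rewrite ler_wpM2r //.
  have kg : kappa ^+ g = kappa * kappa ^+ g.-1 by rewrite -exprS prednK.
  rewrite (exprMn _ kappa h) kg -[in leRHS]mulrA.
  rewrite ler_wpM2r ?mulr_ge0 ?exprn_ge0 // /kappa.
  by rewrite mulrC; lra.
move: i mu phi HU mu0 Hmu; elim: s => [|s IHs] i mu phi HU mu0 Hmu Ds.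
  rewrite subn0 in Ds; rewrite fcoef_support // normr0.
  by rewrite !mulr_ge0 ?exprn_ge0 // expr0 subrr.
have s1 : 1 <= 2 ^+ s :> R by apply: exprn_ege1; rewrite ler1n.
have kh0 : 0 <= kappa ^+ g.-1 * h ^+ g by rewrite mulr_ge0 ?exprn_ge0.
case: i HU Hmu Ds => [|i] HU Hmu Ds.
  by rewrite /= (negbTE mu0) normr0 exprS mulr_ge0 // mulr_ge0 // mulr_ge0 //; lra.
rewrite subSS in Ds.
have HUi j nu psi : (j < i)%N -> `|F j nu psi| <= U j by move=> ji; apply: HU; rewrite ltnS ltnW.
have {}IHs := IHs i mu phi HUi mu0 _ Ds.
have {}IHs : `|F i mu phi| <= (2 ^+ s - 1) * 20 * (kappa ^+ g.-1 * h ^+ g) * U i.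
  apply: IHs; apply: le_trans Hmu; rewrite ler_wpM2l //; lra.
have shifted (l : nat) (e : R) psi : (0 < l)%N -> `|e| = 1 ->
    `|F i (mu + e * (l%:R * w i.+1)) psi| <= (kappa * h) ^+ (g - l) * U i.
  move=> l0 e1; have [lg|gl] := ltnP l g; last first.
    have -> : (g - l = 0)%N by apply/eqP.
    by rewrite expr0 mul1r; apply: HU.
  have lb : (g%:R - l%:R - 1 + theta) * w i.+1 <= `|mu + e * (l%:R * w i.+1)|.
    have : `|mu| <= `|mu + e * (l%:R * w i.+1)| + `|e * (l%:R * w i.+1)|.
      by rewrite -[X in `|X| <= _](addrK (e * (l%:R * w i.+1))); exact: ler_normB.
    rewrite normrM e1 mul1r normrM (ger0_norm (w_ge0 _)) ger0_norm ?ler0n //.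
    by lra.
  have gl1 : 1 <= g%:R - l%:R :> R by rewrite -natrB ?ler1n ?subn_gt0 // ltnW.
  apply: IHg => //; rewrite ?subn_gt0 //; first by rewrite ltn_subrL l0 g0.
    rewrite -normr_gt0; apply: lt_le_trans lb.
    by rewrite mulr_gt0 //; lra.
  apply: le_trans lb; rewrite natrB ?(ltnW lg) //.
  by rewrite ler_wpM2l //; lra.
have step : `|F i.+1 mu phi - factor_coef (b i.+1) 0%N * F i mu phi| <=
    \sum_(1 <= l < 6) h ^+ l * (2 * ((kappa * h) ^+ (g - l) * U i)).
  apply: fcoef_step_le => // l psi l0.
    by have := shifted l 1 psi l0 (normr1 _); rewrite mul1r.
  by have := shifted l (-1) psi l0; rewrite mulN1r; apply; rewrite normrN1.
have {}step := le_trans step (sum_hpow g0 (U0 i)).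
have main : `|F i.+1 mu phi| <= `|F i mu phi| + 10 * (kappa ^+ g.-1 * h ^+ g) * U i.
  rewrite -[F i.+1 mu phi](subrK (factor_coef (b i.+1) 0%N * F i mu phi)) addrC.
  apply: (le_trans (ler_normD _ _)); apply: lerD => //.
  rewrite normrM ler_piMl // factor_coef0_le1 //.
  exact: le_trans (bh _) h1.
apply: (le_trans main).
apply: (le_trans (lerD IHs (lexx _))).
have := U2 i; have := U0 i.+1.
set X := kappa ^+ g.-1 * h ^+ g in kh0 *.
set Y := 2 ^+ s in s1 *.
rewrite exprS -/Y => u0 u2.
rewrite -mulrDl.
have -> : (2 * Y - 1) * 20 * X * U i.+1 = (Y * 2 - 1) * 10 * X * (2 * U i.+1) by ring.
have XY : 0 <= X * (Y - 1) by rewrite mulr_ge0 //; lra.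
by apply: ler_pM => //; lra.
Qed.

Context (g : nat).
Hypothesis g2 : (1 < g)%N.
Hypothesis g4 : (g <= 4)%N.
Hypothesis gq : g%:R - 2 + theta <= q * (1 - theta).

Definition near_const : R := 10 * kappa ^+ g.-1 + 1.

(** Shifting a small frequency by l w_(i+1) costs h^l and lands beyond
    (g - l - 1 + theta) w_i, from where fcoef_far provides the missing h^(g - l).
    The condition gq says exactly this for l = 1, and then it holds for all l. *)
Lemma fcoef_near i nu phi :
  (forall j mu psi, (j <= i)%N -> `|F j mu psi| <= U j) ->
  `|nu| <= theta * w i.+1 ->
  `|F i.+1 nu phi - (1 - b i.+1 ^+ 2 / 4) * F i nu phi| <=
  near_const * h ^+ g * U i.
Proof.
move=> HU Hnu; have gg : (0 < g)%N by apply: ltnW.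
have t0 := theta0; have q0 := q1; have gq' := gq.
have g2R : 2 <= g%:R :> R by rewrite ler_nat.
have theta1 : 0 < 1 - theta.
  rewrite -(pmulr_rgt0 _ (lt_trans ltr01 q1)).
  by apply: lt_le_trans gq; lra.
have shifted (l : nat) (e : R) psi : (0 < l)%N -> `|e| = 1 ->
    `|F i (nu + e * (l%:R * w i.+1)) psi| <= (kappa * h) ^+ (g - l) * U i.
  move=> l0 e1; have [lg|gl] := ltnP l g; last first.
    have -> : (g - l = 0)%N by apply/eqP.
    by rewrite expr0 mul1r; apply: HU.
  have l1 : 1 <= l%:R :> R by rewrite ler1n.
  have lb : (l%:R - theta) * w i.+1 <= `|nu + e * (l%:R * w i.+1)|.
    have : `|e * (l%:R * w i.+1)| <= `|nu + e * (l%:R * w i.+1)| + `|nu|.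
      by rewrite -[X in `|X| <= _](addKr nu) [- nu + _]addrC; exact: ler_normB.
    rewrite normrM e1 mul1r normrM (ger0_norm (w_ge0 _)) ger0_norm ?ler0n //.
    by lra.
  apply: fcoef_far => //; rewrite ?subn_gt0 //.
  + by move=> j mu psi' ji; apply: HU; rewrite ltnW.
  + rewrite -normr_gt0; apply: lt_le_trans lb.
    by rewrite mulr_gt0 //; lra.
  apply: le_trans lb; rewrite natrB ?(ltnW lg) //.
  apply: (@le_trans _ _ ((l%:R - theta) * (q * w i))); last first.
    by rewrite ler_wpM2l //; lra.
  rewrite mulrA ler_wpM2r //.
  have : 0 <= q * (l%:R - 1) by rewrite mulr_ge0 //; lra.
  by lra.
have step : `|F i.+1 nu phi - factor_coef (b i.+1) 0%N * F i nu phi| <=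
    \sum_(1 <= l < 6) h ^+ l * (2 * ((kappa * h) ^+ (g - l) * U i)).
  apply: fcoef_step_le => // l psi l0.
    by have := shifted l 1 psi l0 (normr1 _); rewrite mul1r.
  by have := shifted l (-1) psi l0; rewrite mulN1r; apply; rewrite normrN1.
have {}step := le_trans step (sum_hpow gg (U0 i)).
have -> : F i.+1 nu phi - (1 - b i.+1 ^+ 2 / 4) * F i nu phi =
    (F i.+1 nu phi - factor_coef (b i.+1) 0%N * F i nu phi) + b i.+1 ^+ 4 / 64 * F i nu phi.
  set X := F i.+1 nu phi; set Y := F i nu phi; rewrite /factor_coef.
  by field.
apply: (le_trans (ler_normD _ _)).
have -> : near_const * h ^+ g * U i =
    10 * (kappa ^+ g.-1 * h ^+ g) * U i + h ^+ g * U i by rewrite /near_const; ring.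
apply: lerD => //; rewrite normrM.
apply: ler_pM => //; last exact: HU.
apply: (@le_trans _ _ (h ^+ 4)); last by apply: ler_wiXn2l.
rewrite normrM normrX; have := lerXn2r 4 (normr_ge0 (b i.+1)) h0 (bh i.+1).
rewrite [`|64^-1|]ger0_norm // => Hb.
have : 0 <= `|b i.+1| ^+ 4 by rewrite exprn_ge0.
by lra.
Qed.

End Bound.

Section Growth.
Context (g : nat).
Hypothesis g2 : (1 < g)%N.
Hypothesis g4 : (g <= 4)%N.
Hypothesis gq : g%:R - 2 + theta <= q * (1 - theta).
Hypothesis kh : kappa * h <= 1.

Let e : R := near_const g * h ^+ g.
Let U (i : nat) : R := \prod_(1 <= k < i.+1) (1 - b k ^+ 2 / 4 + e).

Let e0 : 0 <= e.
Proof.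
apply: mulr_ge0; last exact: exprn_ge0.
rewrite /near_const; apply: addr_ge0 => //; apply: mulr_ge0 => //.
by apply: exprn_ge0; apply: le_trans kappa_ge1.
Qed.

Let bb k : 0 <= b k ^+ 2 <= 1.
Proof.
rewrite sqr_ge0 -[b k ^+ 2]ger0_norm ?sqr_ge0 // normrX exprn_ile1 //.
exact: le_trans h1.
Qed.

Let U0 i : 0 <= U i.
Proof.
rewrite /U big_nat; apply: prodr_ge0 => k _.
by have := e0; have /andP[? ?] := bb k; lra.
Qed.

Let US i : U i.+1 = U i * (1 - b i.+1 ^+ 2 / 4 + e).
Proof. by rewrite /U big_nat_recr. Qed.

Let U2 j : U j <= 2 * U j.+1.
Proof.
have e0' := e0; rewrite US mulrCA -[leLHS]mulr1 ler_wpM2l //.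
by have /andP[? ?] := bb j.+1; lra.
Qed.

(** Both kinds of frequencies keep the bound: small ones by fcoef_near, the others
    because fcoef_far with g = 1 gains a factor kappa h <= 1. *)
Lemma fcoef_le_prod i nu phi : `|F i nu phi| <= U i.
Proof.
elim/ltn_ind: i nu phi => -[|i] IH nu phi.
  rewrite /U big_geq //=; case: ifP => _; last by rewrite normr0.
  by rewrite ler_norml cos_le1 cos_geN1.
have [nu_le|nu_gt] := leP `|nu| (theta * w i.+1).
  rewrite US mulrDr -(subrK ((1 - b i.+1 ^+ 2 / 4) * F i nu phi) (F i.+1 nu phi)).
  rewrite addrC; apply: (le_trans (ler_normD _ _)); apply: lerD.
    have /andP[? ?] := bb i.+1; have c0 : 0 <= 1 - b i.+1 ^+ 2 / 4 by lra.
    by rewrite normrM (ger0_norm c0) mulrC ler_wpM2r ?IH.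
  rewrite [U i * e]mulrC; apply: fcoef_near => //.
  by move=> j mu psi ji; apply: IH; rewrite ltnS.
have wp : 0 < theta * w i.+1 by rewrite mulr_gt0.
apply: (@le_trans _ _ ((kappa * h) ^+ 1 * U i.+1)).
  apply: fcoef_far => //.
  - by move=> j mu psi ji; apply: IH.
  - by rewrite -normr_gt0; apply: lt_trans nu_gt.
  by rewrite subrr add0r ltW.
by rewrite expr1 ler_piMl.
Qed.

Lemma fcoef_sub_prod i n phi : (i <= n)%N ->
  `|F i 0 phi - cos phi * \prod_(1 <= k < i.+1) (1 - b k ^+ 2 / 4)| <=
  i%:R * e * expR (n%:R * e).
Proof.
have e0' := e0.
elim: i => [|i IH] ilen.
  by rewrite big_geq //= eqxx mulr1 subrr normr0 !mul0r.
rewrite big_nat_recr //=; set P := \prod_(_ <= _ < _) _ in IH *.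
have -> : F i.+1 0 phi - cos phi * (P * (1 - b i.+1 ^+ 2 / 4)) =
  (F i.+1 0 phi - (1 - b i.+1 ^+ 2 / 4) * F i 0 phi) +
  (1 - b i.+1 ^+ 2 / 4) * (F i 0 phi - cos phi * P) by ring.
apply: (le_trans (ler_normD _ _)).
set E := expR _ in IH *.
have -> : i.+1%:R * e * E = e * E + i%:R * e * E by rewrite -[i.+1%:R]natr1; ring.
rewrite [leRHS]addrC [leLHS]addrC; apply: lerD.
  have /andP[? ?] := bb i.+1.
  rewrite normrM; apply: le_trans (IH (ltnW ilen)); rewrite ler_piMl //.
  by rewrite ler_norml; apply/andP; split; lra.
apply: (@le_trans _ _ (e * U i)).
  apply: fcoef_near => //; first by move=> j mu psi _; exact: fcoef_le_prod.
  by rewrite normr0 mulr_ge0 // ltW.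
rewrite ler_wpM2l //.
apply: (@le_trans _ _ (\prod_(1 <= k < i.+1) expR e)).
  rewrite /U !big_nat; apply: ler_prod => k _; have /andP[? ?] := bb k.
  by have := expR_ge1Dx e; move=> ?; apply/andP; split; lra.
rewrite -expR_sum ler_expR sumr_const_nat subn1 /= -[e *+ i]mulr_natl.
by rewrite ler_wpM2r // ler_nat ltnW.
Qed.

Lemma fcoef_le_exp n nu phi :
  `|F n nu phi| <= expR (- (\sum_(1 <= k < n.+1) b k ^+ 2) / 4 + n%:R * e).
Proof.
have e0' := e0.
apply: (le_trans (fcoef_le_prod _ _ _)).
apply: (@le_trans _ _ (\prod_(1 <= k < n.+1) expR (- (b k ^+ 2 / 4) + e))).
  rewrite /U !big_nat; apply: ler_prod => k _; have /andP[? ?] := bb k.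
  by have := expR_ge1Dx (- (b k ^+ 2 / 4) + e) => ?; apply/andP; split; lra.
rewrite -expR_sum ler_expR big_split /= sumr_const_nat subn1 /= mulr_natl.
by rewrite sumrN mulNr mulr_suml.
Qed.

End Growth.
End Lacunary.

(** The two conclusions serve different ranges of b: the first, for domination,
    is useful when the sum of the squares is large, the second, for the
    pointwise limit, when it is bounded. *)
Lemma lacunary_fcoef (q : R) (g : nat) :
  1 < q -> (1 < g <= 4)%N -> g%:R - 2 < q ->
  exists C h0 : R, [/\ 0 <= C, 0 < h0 &
    forall (w b : nat -> R) (h : R) (n : nat),
      w 0%N = 0 -> (forall k, 0 < w k.+1) -> (forall k, q * w k <= w k.+1) ->
      (forall k, `|b k| <= h) -> h <= h0 ->
      forall phi,
        `|fcoef w b n 0 phi| <=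
          expR (- (\sum_(1 <= k < n.+1) b k ^+ 2) / 4 + n%:R * (C * h ^+ g)) /\
        `|fcoef w b n 0 phi -
           cos phi * \prod_(1 <= k < n.+1) (1 - b k ^+ 2 / 4)| <=
          n%:R * (C * h ^+ g) * expR (n%:R * (C * h ^+ g))].
Proof.
move=> q1 /andP[g2 g4] gq.
pose theta := (q - (g%:R - 2)) / (q + 1).
have theta0 : 0 < theta by rewrite divr_gt0 //; lra.
have q0 : 0 < q by exact: lt_trans q1.
(* After L steps a frequency theta w_i lies outside the support. *)
have [L qL] : exists L, 5 * q / (q - 1) < theta * q ^+ L.
  pose y := 5 * q / (q - 1) / theta.
  have d0 : 0 < q - 1 by rewrite subr_gt0.
  have [L HL] : exists L : nat, y / (q - 1) < L%:R.
    exists (Num.bound (y / (q - 1))); apply: archi_boundP.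
    by rewrite /y; do 3 (apply: divr_ge0; last exact: ltW); rewrite mulr_ge0 // ltW.
  exists L; rewrite [theta * _]mulrC -ltr_pdivrMr // -/y.
  rewrite ltr_pdivrMr // in HL; apply: (lt_le_trans HL) => {HL}.
  elim: L => [|L IH]; first by rewrite mul0r expr0.
  have : 1 <= q ^+ L by rewrite exprn_ege1 // ltW.
  by rewrite exprS -natr1; move: IH; nra.
pose C := near_const L g.
exists C, (20 * 2 ^+ L)^-1.
have K1 : 1 <= 20 * 2 ^+ L :> R.
  have : 1 <= 2 ^+ L :> R by apply: exprn_ege1; rewrite ler1n.
  by lra.
have K0 : 0 < 20 * 2 ^+ L :> R by apply: lt_le_trans K1.
split.
- by rewrite /C /near_const addr_ge0 // mulr_ge0 // exprn_ge0 // ltW.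
- by rewrite invr_gt0.
move=> w b h n w0 w_gt0 w_gap bh hh0 phi.
have h1 : h <= 1 by apply: (le_trans hh0); rewrite invf_le1.
have kh : 20 * 2 ^+ L * h <= 1 by rewrite -ler_pdivlMl // mulr1.
have gq' : g%:R - 2 + theta <= q * (1 - theta).
  rewrite le_eqVlt; apply/orP; left; apply/eqP; rewrite /theta; field.
  by rewrite gt_eqF //; lra.
split.
  exact: (fcoef_le_exp q1 theta0 w0 w_gt0 w_gap bh h1 qL g2 g4 gq' kh).
exact: (fcoef_sub_prod q1 theta0 w0 w_gt0 w_gap bh h1 qL g2 g4 gq' kh).
Qed.

End FourierCoefficients.

(** * Calculus on the line and Taylor bounds *)

Section SegmentIntegrals.
Context (R : realType).
Implicit Types (f F : R -> R) (a b : R).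
Local Notation mu := (@lebesgue_measure R).

Lemma continuous_segment_integrable a b f : continuous f ->
  mu.-integrable `[a, b] (EFin \o f).
Proof.
move=> cf; apply: continuous_compact_integrable; first exact: segment_compact.
exact: continuous_subspaceT.
Qed.

Lemma segment_FTC a b f F : a < b -> continuous f ->
  (forall x, is_derive x (1:R) F (f x)) ->
  \int[mu]_(x in `[a, b]) f x = F b - F a.
Proof.
move=> ab cf dF; have cF : continuous F.
  by move=> x; apply/differentiable_continuous/derivable1_diffP.
rewrite /Rintegral (continuous_FTC2 (F := F) ab) //.
- exact: continuous_subspaceT.
- split => //.
  + by apply: cvg_at_right_filter; apply: cF.
  + by apply: cvg_at_left_filter; apply: cF.
- by move=> x _; rewrite derive1E; exact: derive_val.
Qed.

End SegmentIntegrals.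

(** The derivation rules are restated for functions given pointwise, so that they
    can be applied by matching the body of a lambda term. *)
Section PointwiseDerivatives.
Context (R : realType).
Implicit Types (f g : R -> R) (x c : R).

Lemma is_derive_fun_id x : is_derive x (1 : R) (fun z : R => z) 1.
Proof. exact: is_derive_id. Qed.

Lemma is_derive_fun_cst c x : is_derive x (1 : R) (fun _ : R => c) 0.
Proof. exact: is_derive_cst. Qed.

Lemma is_derive_fun_add f g x df dg :
  is_derive x (1 : R) f df -> is_derive x (1 : R) g dg ->
  is_derive x (1 : R) (fun z => f z + g z) (df + dg).
Proof. by move=> hf hg; exact: is_deriveD. Qed.

Lemma is_derive_fun_opp f x df :
  is_derive x (1 : R) f df -> is_derive x (1 : R) (fun z => - f z) (- df).
Proof. by move=> hf; exact: is_deriveN. Qed.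

Lemma is_derive_fun_mul f g x df dg :
  is_derive x (1 : R) f df -> is_derive x (1 : R) g dg ->
  is_derive x (1 : R) (fun z => f z * g z) (f x * dg + g x * df).
Proof. by move=> hf hg; exact: is_deriveM. Qed.

Lemma is_derive_fun_exp f x df n :
  is_derive x (1 : R) f df ->
  is_derive x (1 : R) (fun z => f z ^+ n) (n%:R * f x ^+ n.-1 * df).
Proof.
move=> hf; rewrite (_ : (fun z => f z ^+ n) = f ^+ n); last first.
  by apply/funext => z; rewrite exprfctE.
exact: is_deriveX.
Qed.

Lemma is_derive_fun_sin f x df :
  is_derive x (1 : R) f df -> is_derive x (1 : R) (fun z => sin (f z)) (cos (f x) * df).
Proof.
by move=> hf; exact: (is_derive1_comp _ hf).
Qed.

Lemma is_derive_fun_cos f x df :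
  is_derive x (1 : R) f df -> is_derive x (1 : R) (fun z => cos (f z)) (- sin (f x) * df).
Proof.
by move=> hf; exact: (is_derive1_comp _ hf).
Qed.

End PointwiseDerivatives.

Ltac derive_fun :=
  first [ exact: is_derive_fun_id | exact: is_derive_fun_cst
  | notypeclasses refine (is_derive_fun_add _ _); derive_fun
  | notypeclasses refine (is_derive_fun_opp _); derive_fun
  | notypeclasses refine (is_derive_fun_mul _ _); derive_fun
  | notypeclasses refine (is_derive_fun_exp _ _); derive_fun
  | notypeclasses refine (is_derive_fun_sin _); derive_fun
  | notypeclasses refine (is_derive_fun_cos _); derive_fun ].

Ltac compute_derive :=
  notypeclasses refine (is_derive_eq _ _); [derive_fun | rewrite /=].

Section Taylor.
Context (R : realType).

Let nonneg_of_derive (f df : R -> R) :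
  (forall x, is_derive x (1:R) f (df x)) -> f 0 = 0 ->
  (forall x, 0 <= x -> 0 <= df x) -> forall x, 0 <= x -> 0 <= f x.
Proof.
move=> Df f0 df0 x x0; rewrite -f0.
have cf : continuous f.
  by move=> z; apply/differentiable_continuous/derivable1_diffP.
apply: (@ger0_derive1_ndecry _ f 0) => //.
- move=> z; rewrite in_itv /= andbT => z0.
  by rewrite derive1E derive_val df0 // ltW.
- exact: continuous_subspaceT.
Qed.

Definition cos_taylor (y : R) : R := 1 - y ^+ 2 / 2 + y ^+ 4 / 24.
Definition sin_taylor (y : R) : R := y - y ^+ 3 / 6 + y ^+ 5 / 120.

(** Each inequality is obtained from the previous one by integration from 0. *)
Let sin_cos_taylor_ge0 (x : R) : 0 <= x ->
  [/\ 1 - x ^+ 2 / 2 <= cos x, cos x <= cos_taylor x & cos_taylor x - x ^+ 6 / 720 <= cos x] /\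
   sin_taylor x - x ^+ 7 / 5040 <= sin x <= sin_taylor x.
Proof.
have C0 (y : R) : 0 <= y -> 0 <= 1 - cos y by rewrite subr_ge0 cos_le1.
have S1 : forall y : R, 0 <= y -> 0 <= y - sin y.
  apply: nonneg_of_derive C0; last by rewrite sin0 subrr.
have C2 : forall y : R, 0 <= y -> 0 <= cos y - (1 - y ^+ 2 / 2).
  apply: nonneg_of_derive S1; last by rewrite cos0; field.
  by move=> y; compute_derive; field.
have S3 : forall y : R, 0 <= y -> 0 <= sin y - (y - y ^+ 3 / 6).
  apply: nonneg_of_derive C2; last by rewrite sin0; field.
  by move=> y; compute_derive; field.
have C4 : forall y : R, 0 <= y -> 0 <= cos_taylor y - cos y.
  apply: nonneg_of_derive S3; last by rewrite cos0 /cos_taylor; field.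
  by move=> y; compute_derive; field.
have S5 : forall y : R, 0 <= y -> 0 <= sin_taylor y - sin y.
  apply: nonneg_of_derive C4; last by rewrite sin0 /sin_taylor; field.
  by move=> y; compute_derive; rewrite /cos_taylor; field.
have C6 : forall y : R, 0 <= y -> 0 <= cos y - (cos_taylor y - y ^+ 6 / 720).
  apply: nonneg_of_derive S5; last by rewrite cos0 /cos_taylor; field.
  by move=> y; compute_derive; rewrite /sin_taylor; field.
have S7 : forall y : R, 0 <= y -> 0 <= sin y - (sin_taylor y - y ^+ 7 / 5040).
  apply: nonneg_of_derive C6; last by rewrite sin0 /sin_taylor; field.
  by move=> y; compute_derive; rewrite /cos_taylor; field.
move=> x0; split; [split|apply/andP; split]; rewrite -subr_ge0;
  [exact: C2|exact: C4|exact: C6|exact: S7|exact: S5].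
Qed.

Lemma cos_ge_taylor2 (x : R) : 1 - x ^+ 2 / 2 <= cos x.
Proof.
wlog x0 : x / 0 <= x => [H|]; last by have [[]] := sin_cos_taylor_ge0 x0.
have [/H//|x0] := leP 0 x.
by have := H (- x); rewrite cosN sqrrN oppr_ge0; apply; exact: ltW.
Qed.

Lemma cos_le_taylor4 (x : R) : cos x <= cos_taylor x.
Proof.
wlog x0 : x / 0 <= x => [H|]; last by have [[]] := sin_cos_taylor_ge0 x0.
have [/H//|x0] := leP 0 x.
have -> : cos_taylor x = cos_taylor (- x) by rewrite /cos_taylor; ring.
by rewrite -cosN; apply: H; rewrite oppr_ge0 ltW.
Qed.

Lemma cos_taylor_error (x : R) : `|x| <= 1 -> `|cos x - cos_taylor x| <= `|x| ^+ 6.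
Proof.
wlog x0 : x / 0 <= x => [H|].
  have [/H//|x0] := leP 0 x => x1.
  have := H (- x); rewrite normrN oppr_ge0 cosN => /(_ (ltW x0) x1).
  by congr (`|_ - _| <= _); rewrite /cos_taylor; ring.
rewrite (ger0_norm x0) => x1; have [[_ H1 H2] _] := sin_cos_taylor_ge0 x0.
have : 0 <= x ^+ 6 by exact: exprn_ge0.
by rewrite ler_norml => x6; apply/andP; split; lra.
Qed.

Lemma sin_taylor_error (x : R) : `|x| <= 1 -> `|sin x - sin_taylor x| <= `|x| ^+ 6.
Proof.
wlog x0 : x / 0 <= x => [H|].
  have [/H//|x0] := leP 0 x => x1.
  have := H (- x); rewrite normrN oppr_ge0 sinN => /(_ (ltW x0) x1).
  have -> : sin x - sin_taylor x = - (- sin x - sin_taylor (- x)) by rewrite /sin_taylor; ring.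
  by rewrite normrN.
rewrite (ger0_norm x0) => x1; have [_ /andP[H1 H2]] := sin_cos_taylor_ge0 x0.
have : 0 <= x ^+ 6 by exact: exprn_ge0.
have : x ^+ 7 <= x ^+ 6 by rewrite exprS ler_piMl // exprn_ge0.
by rewrite ler_norml => x6 x7; apply/andP; split; lra.
Qed.

End Taylor.

(** * Products of truncated exponentials *)

Section PhasedProduct.
Context (R : realType).
Implicit Types (y : nat -> R) (alpha beta : R).

(** The real part of e^(i alpha) times the product of the Taylor polynomials of
    e^(i y_k).  Multiplication by i is the shift of alpha by pi/2. *)
Fixpoint phased_prod y (i : nat) alpha : R :=
  if i is j.+1 then
    cos_taylor (y i) * phased_prod y j alpha +
    sin_taylor (y i) * phased_prod y j (alpha + pi / 2)
  else cos alpha.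

(** As a function of the phase the product is a sinusoid. *)
Lemma phased_prodD y i alpha beta :
  phased_prod y i (alpha + beta) =
  cos beta * phased_prod y i alpha + sin beta * phased_prod y i (alpha + pi / 2).
Proof.
elim: i alpha beta => [|i IH] alpha beta /=.
  by rewrite cosDpihalf cosD; ring.
by rewrite (addrAC alpha beta) (IH alpha beta) (IH (alpha + pi / 2) beta); ring.
Qed.

Lemma phased_prod_halfturn y i alpha :
  phased_prod y i (alpha + pi / 2 + pi / 2) = - phased_prod y i alpha.
Proof.
rewrite (_ : alpha + pi / 2 + pi / 2 = alpha + pi); last by field.
by rewrite phased_prodD cospi sinpi; ring.
Qed.

(** Dividing each factor by e^(i y_k), that is, turning the phase back by the sum
    of the y_k, leaves factors 1 + O(h^6), whose errors multiply harmlessly. *)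
Lemma phased_prod_near_cos y h i alpha :
  (forall k, `|y k| <= h) -> h <= 1 ->
  `|phased_prod y i (alpha - \sum_(1 <= k < i.+1) y k) - cos alpha| <=
    (1 + 4 * h ^+ 6) ^+ i - 1.
Proof.
move=> yh h1; have h0 : 0 <= h by exact: le_trans (normr_ge0 _) (yh 0%N).
set d := 4 * h ^+ 6.
have d0 : 0 <= d by rewrite mulr_ge0 ?exprn_ge0.
elim: i alpha => [|i IH] alpha.
  by rewrite big_geq //= subr0 subrr normr0 expr0 subrr.
rewrite big_nat_recr //=; set Y := \sum_(_ <= _ < _) _ in IH *.
set v := y i.+1; have v1 : `|v| <= 1 by exact: le_trans (yh _) h1.
have v6 : `|v| ^+ 6 <= h ^+ 6 by rewrite lerXn2r // ?nnegrE // yh.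
set T := phased_prod y i in IH *.
(* e1 + i e2 is the quotient of the Taylor polynomial by e^(i v). *)
pose e1 := cos_taylor v * cos v + sin_taylor v * sin v.
pose e2 := sin_taylor v * cos v - cos_taylor v * sin v.
have csn (x : R) : `|cos x| <= 1 by rewrite ler_norml cos_le1 cos_geN1.
have snn (x : R) : `|sin x| <= 1 by rewrite ler_norml sin_le1 sin_geN1.
have small (p r s t : R) : `|p| <= h ^+ 6 -> `|r| <= h ^+ 6 ->
    `|s| <= 1 -> `|t| <= 1 -> `|p * s + r * t| <= 2 * h ^+ 6.
  move=> p6 r6 s1 t1; apply: (le_trans (ler_normD _ _)).
  rewrite mulr2n mulrDl mul1r !normrM; apply: lerD.
    by rewrite -[leRHS]mulr1 ler_pM.
  by rewrite -[leRHS]mulr1 ler_pM.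
have cv : `|cos_taylor v - cos v| <= h ^+ 6.
  by rewrite distrC; apply: le_trans (cos_taylor_error v1) v6.
have sv : `|sin_taylor v - sin v| <= h ^+ 6.
  by rewrite distrC; apply: le_trans (sin_taylor_error v1) v6.
have E1 : `|e1 - 1| <= 2 * h ^+ 6.
  rewrite (_ : e1 - 1 = (cos_taylor v - cos v) * cos v + (sin_taylor v - sin v) * sin v).
    exact: small.
  by rewrite -(cos2Dsin2 v) /e1; ring.
have E2 : `|e2| <= 2 * h ^+ 6.
  rewrite (_ : e2 = (sin_taylor v - sin v) * cos v + (cos_taylor v - cos v) * - sin v).
    by apply: small => //; rewrite normrN.
  by rewrite /e2; ring.
pose D := (1 + d) ^+ i - 1.
have D0 : 0 <= D by rewrite subr_ge0 exprn_ege1 // lerDl.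
have -> : cos_taylor v * T (alpha - (Y + v)) + sin_taylor v * T (alpha - (Y + v) + pi / 2)
    - cos alpha =
  (e1 * (T (alpha - Y) - cos alpha) +
   e2 * (T (alpha + pi / 2 - Y) - cos (alpha + pi / 2))) +
  ((e1 - 1) * cos alpha + e2 * - sin alpha).
  rewrite (_ : alpha - (Y + v) = alpha - Y + - v); last by ring.
  rewrite (addrAC _ (- v)) /T (phased_prodD _ _ (alpha - Y))
    (phased_prodD _ _ (alpha - Y + pi / 2)) phased_prod_halfturn.
  rewrite cosN sinN cosDpihalf (addrAC alpha _ (- Y)) /e1 /e2.
  by ring.
apply: (le_trans (ler_normD _ _)).
have I1 : `|(e1 - 1) * cos alpha + e2 * - sin alpha| <= d.
  apply: (le_trans (ler_normD _ _)); rewrite !normrM normrN.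
  have -> : d = 2 * h ^+ 6 + 2 * h ^+ 6 by rewrite /d; ring.
  by apply: lerD; rewrite -[leRHS]mulr1 ler_pM.
have I2 : `|e1 * (T (alpha - Y) - cos alpha) +
   e2 * (T (alpha + pi / 2 - Y) - cos (alpha + pi / 2))| <= (1 + d) * D.
  apply: (le_trans (ler_normD _ _)); rewrite !normrM.
  have -> : (1 + d) * D = (1 + 2 * h ^+ 6) * D + 2 * h ^+ 6 * D.
    by rewrite /d; ring.
  apply: lerD; apply: ler_pM => //; rewrite ?IH //.
  rewrite -[e1](subrK 1) addrC; apply: (le_trans (ler_normD _ _)).
  by rewrite normr1 lerD2l.
apply: (le_trans (lerD I2 I1)).
by rewrite exprS /D; lra.
Qed.

Let cos_multiple (theta : R) n :
  cos (n.+2%:R * theta) = 2 * cos theta * cos (n.+1%:R * theta) - cos (n%:R * theta).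
Proof.
have -> : n.+2%:R * theta = n.+1%:R * theta + theta.
  by rewrite -[n.+2%:R]natr1; ring.
have -> : n%:R * theta = n.+1%:R * theta - theta.
  by rewrite -[n.+1%:R]natr1; ring.
by rewrite cosB cosD; ring.
Qed.

(** Powers of cos theta are expanded in multiple angles, and each
    2 cos (l theta) is split into two opposite shifts of the phase. *)
Lemma phased_prod_fourier y i alpha (b theta : R) :
  y i.+1 = b * cos theta ->
  phased_prod y i.+1 alpha = factor_coef b 0%N * phased_prod y i alpha +
    \sum_(1 <= l < 6) factor_coef b l *
      (phased_prod y i (alpha + phase_shift R l + l%:R * theta) +
       phased_prod y i (alpha + phase_shift R l - l%:R * theta)).
Proof.
move=> yb /=; rewrite yb.
have pair beta (l : nat) :
    phased_prod y i (beta + l%:R * theta) + phased_prod y i (beta - l%:R * theta) =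
    2 * cos (l%:R * theta) * phased_prod y i beta.
  rewrite (phased_prodD _ _ beta (l%:R * theta)).
  by rewrite (phased_prodD _ _ beta (- (l%:R * theta))) cosN sinN; ring.
under eq_bigr do rewrite pair.
do 5 rewrite big_ltn //; rewrite big_geq // /phase_shift /= !addr0.
have c0 : cos (0%:R * theta) = 1 by rewrite mul0r cos0.
have c1 : cos (1%:R * theta) = cos theta by rewrite mul1r.
rewrite !cos_multiple c0 c1 /cos_taylor /sin_taylor.
by field.
Qed.

End PhasedProduct.

(** * Means over the unit interval *)

Section ContinuityRules.
Context (R : realType).
Implicit Types (f g : R -> R).

Lemma continuous_fun_id : continuous (fun x : R => x).
Proof. by move=> x; exact: cvg_id. Qed.

Lemma continuous_fun_cst (c : R) : continuous (fun _ : R => c).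
Proof. by move=> x; exact: cvg_cst. Qed.

Lemma continuous_fun_add f g : continuous f -> continuous g ->
  continuous (fun x => f x + g x).
Proof. by move=> cf cg x; exact: cvgD (cf x) (cg x). Qed.

Lemma continuous_fun_opp f : continuous f -> continuous (fun x => - f x).
Proof. by move=> cf x; exact: cvgN (cf x). Qed.

Lemma continuous_fun_mul f g : continuous f -> continuous g ->
  continuous (fun x => f x * g x).
Proof. by move=> cf cg x; exact: cvgM (cf x) (cg x). Qed.

Lemma continuous_fun_exp f n : continuous f -> continuous (fun x => f x ^+ n).
Proof.
move=> cf; elim: n => [|n IH]; first exact: continuous_fun_cst.
by under eq_fun do rewrite exprS; exact: continuous_fun_mul.
Qed.

Lemma continuous_fun_cos f : continuous f -> continuous (fun x => cos (f x)).
Proof. by move=> cf x; apply: continuous_comp; [exact: cf|exact: continuous_cos]. Qed.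

Lemma continuous_fun_sin f : continuous f -> continuous (fun x => sin (f x)).
Proof. by move=> cf x; apply: continuous_comp; [exact: cf|exact: continuous_sin]. Qed.

Lemma continuous_fun_expR f : continuous f -> continuous (fun x => expR (f x)).
Proof. by move=> cf x; apply: continuous_comp; [exact: cf|exact: continuous_expR]. Qed.

Lemma continuous_fun_sum (I : Type) (r : seq I) (F : I -> R -> R) :
  (forall i, continuous (F i)) -> continuous (fun x => \sum_(i <- r) F i x).
Proof.
move=> cF; elim: r => [|i r IH].
  by under eq_fun do rewrite big_nil; exact: continuous_fun_cst.
by under eq_fun do rewrite big_cons; exact: continuous_fun_add.
Qed.

End ContinuityRules.

Ltac continuity :=
  lazymatch goal with
  | |- forall z, continuous_at z (fun _ => ?c) => exact: continuous_fun_cst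
  | |- forall z, continuous_at z (fun x => x) => exact: continuous_fun_id
  | |- forall z, continuous_at z (fun x => @?f x + @?g x) =>
      apply: (@continuous_fun_add _ f g); continuity
  | |- forall z, continuous_at z (fun x => - @?f x) =>
      apply: (@continuous_fun_opp _ f); continuity
  | |- forall z, continuous_at z (fun x => @?f x * @?g x) =>
      apply: (@continuous_fun_mul _ f g); continuity
  | |- forall z, continuous_at z (fun x => @?f x ^+ ?n) =>
      apply: (@continuous_fun_exp _ f n); continuity
  | |- forall z, continuous_at z (fun x => cos (@?f x)) =>
      apply: (@continuous_fun_cos _ f); continuity
  | |- forall z, continuous_at z (fun x => sin (@?f x)) =>
      apply: (@continuous_fun_sin _ f); continuity
  | |- forall z, continuous_at z (fun x => expR (@?f x)) =>
      apply: (@continuous_fun_expR _ f); continuity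
  | |- _ => by auto
  end.

Section SegmentLinearity.
Context (R : realType).
Implicit Types (f g : R -> R) (a b c : R).
Local Notation mu := (@lebesgue_measure R).

Lemma segment_integralD a b f g : continuous f -> continuous g ->
  \int[mu]_(x in `[a, b]) (f x + g x) =
  \int[mu]_(x in `[a, b]) f x + \int[mu]_(x in `[a, b]) g x.
Proof. by move=> cf cg; rewrite RintegralD //; exact: continuous_segment_integrable. Qed.

Lemma segment_integralZ a b c f : continuous f ->
  \int[mu]_(x in `[a, b]) (c * f x) = c * \int[mu]_(x in `[a, b]) f x.
Proof. by move=> cf; rewrite RintegralZl //; exact: continuous_segment_integrable. Qed.

Lemma segment_integral_sum a b (I : Type) (r : seq I) (F : I -> R -> R) :
  (forall i, continuous (F i)) ->
  \int[mu]_(x in `[a, b]) (\sum_(i <- r) F i x) =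
  \sum_(i <- r) \int[mu]_(x in `[a, b]) F i x.
Proof.
move=> cF; elim: r => [|i r IH].
  under eq_Rintegral do rewrite big_nil.
  by rewrite big_nil Rintegral_cst // mul0r.
under eq_Rintegral do rewrite big_cons.
by rewrite segment_integralD ?IH ?big_cons //; exact: continuous_fun_sum.
Qed.

End SegmentLinearity.

Section Characteristic.
Context (R : realType).
Local Notation mu := (@lebesgue_measure R).
Implicit Types (w b : nat -> R) (nu phi : R).

Lemma continuous_phased_prod (y : nat -> R -> R) i (f : R -> R) :
  (forall k, continuous (y k)) -> continuous f ->
  continuous (fun x => phased_prod (y ^~ x) i (f x)).
Proof.
move=> cy; elim: i f => [|i IH] f cf /=; first by continuity.
apply: continuous_fun_add; apply: continuous_fun_mul; try exact: IH.
- by rewrite /cos_taylor; continuity.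
- by rewrite /sin_taylor; continuity.
- by apply: IH; continuity.
Qed.

Let integral_cos_int (nu phi : R) : nu \is a Num.int ->
  \int[mu]_(x in `[0, 1]) cos (2 * pi * nu * x + phi) =
  if nu == 0 then cos phi else 0.
Proof.
move=> nuZ; case: eqP => [->|/eqP nu0].
  under eq_Rintegral do rewrite mulr0 mul0r add0r.
  by rewrite Rintegral_cst //= lebesgue_measure_itv /= lte_fin ltr01 oppr0 addr0 mulr1.
have p0 : 2 * pi * nu != 0 :> R by rewrite !mulf_neq0 // gt_eqF // pi_gt0.
have dF (x : R) : is_derive x (1 : R)
    (fun x => (2 * pi * nu)^-1 * sin (2 * pi * nu * x + phi))
    (cos (2 * pi * nu * x + phi)).
  compute_derive; rewrite ?(mul0r, mulr0, addr0, add0r, mulr1).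
  by rewrite mulrCA mulVf // mulr1.
rewrite (segment_FTC ltr01 _ dF); last by continuity.
rewrite mulr1 mulr0 add0r -mulrBr.
have /intrP[z ->] := nuZ.
suff -> : sin (2 * pi * z%:~R + phi) = sin phi by rewrite subrr mulr0.
have sinDn (n : nat) (t : R) : sin (2 * pi * n%:R + t) = sin t.
  elim: n t => [|n IH] t; first by rewrite mulr0 add0r.
  rewrite -[RHS]IH -[RHS]sinD2pi -[n.+1%:R]natr1; congr sin; ring.
case: z => n; first by rewrite sinDn.
by rewrite NegzE mulrNz mulrN -(sinDn n.+1) addrA subrr add0r.
Qed.

(** Both sides satisfy the same recursion.  Integer frequencies enter through the
    initial value only: the mean of cos (2 pi nu x + phi) vanishes unless nu = 0. *)
Lemma integral_phased_prod w b i nu phi :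
  (forall k, w k \is a Num.int) -> nu \is a Num.int ->
  \int[mu]_(x in `[0, 1])
    phased_prod (fun k => b k * cos (2 * pi * w k * x)) i (2 * pi * nu * x + phi) =
  fcoef w b i nu phi.
Proof.
move=> wZ; elim: i nu phi => [|i IH] nu phi nuZ; first exact: integral_cos_int.
pose y k x := b k * cos (2 * pi * w k * x).
have cy k : continuous (y k) by rewrite /y; continuity.
transitivity (\int[mu]_(x in `[0, 1])
  (factor_coef (b i.+1) 0%N * phased_prod (y ^~ x) i (2 * pi * nu * x + phi) +
   \sum_(1 <= l < 6) factor_coef (b i.+1) l *
     (phased_prod (y ^~ x) i (2 * pi * (nu + l%:R * w i.+1) * x + (phi + phase_shift R l)) +
      phased_prod (y ^~ x) i (2 * pi * (nu - l%:R * w i.+1) * x + (phi + phase_shift R l))))).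
  apply: eq_Rintegral => x _.
  rewrite (@phased_prod_fourier _ (y ^~ x) i _ (b i.+1) (2 * pi * w i.+1 * x)) //.
  congr (_ + _); apply: eq_bigr => l _; congr (_ * (_ + _));
    by congr phased_prod; ring.
have cp nu' phi' : continuous (fun x => phased_prod (y ^~ x) i (2 * pi * nu' * x + phi')).
  by apply: continuous_phased_prod => //; continuity.
rewrite segment_integralD; last 2 first.
- by apply: continuous_fun_mul => //; continuity.
- apply: continuous_fun_sum => l; apply: continuous_fun_mul; first by continuity.
  exact: continuous_fun_add.
rewrite segment_integralZ // IH // segment_integral_sum; last first.
  move=> l; apply: continuous_fun_mul; first by continuity.
  exact: continuous_fun_add.
congr (_ + _); apply: eq_bigr => l _.
rewrite segment_integralZ; last exact: continuous_fun_add.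
have lw : l%:R * w i.+1 \is a Num.int by rewrite rpredM ?rpred_nat.
by rewrite segment_integralD // !IH // rpredD ?rpredN.
Qed.

End Characteristic.

(** * The characteristic function of the trigonometric sum *)

Section TrigSumCharacteristic.
Context (R : realType).
Local Notation mu := (@lebesgue_measure R).

(** The real part of e^(i phi) times the characteristic function of S at t; the
    phase gives access to the imaginary part as well. *)
Definition char_cos (S : R -> R) (t phi : R) : R :=
  \int[mu]_(x in `[0, 1]) cos (t * S x + phi).

Lemma segment_integral_dist_le (f : R -> R) (c e : R) :
  continuous f -> (forall x, `|f x - c| <= e) ->
  `|\int[mu]_(x in `[0, 1]) f x - c| <= e.
Proof.
move=> cf fe.
have m1 : fine (mu `[0, 1]%classic) = 1.
  by rewrite lebesgue_measure_itv /= lte_fin ltr01 oppr0 addr0.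
have cst (r : R) : \int[mu]_(x in `[0, 1]) r = r.
  by rewrite Rintegral_cst // m1 mulr1.
have ifc := continuous_segment_integrable 0 1 cf.
have ie (r : R) : mu.-integrable `[0, 1] (EFin \o (fun _ : R => r)).
  by apply: continuous_segment_integrable; exact: continuous_fun_cst.
rewrite ler_distl; apply/andP; split.
  rewrite -[leLHS]cst; apply: le_Rintegral => // x _.
  by have := fe x; rewrite ler_distl => /andP[].
rewrite -[leRHS]cst; apply: le_Rintegral => // x _.
by have := fe x; rewrite ler_distl => /andP[].
Qed.

Lemma segment_integral_dist (f g : R -> R) (e : R) :
  continuous f -> continuous g -> (forall x, `|f x - g x| <= e) ->
  `|\int[mu]_(x in `[0, 1]) f x - \int[mu]_(x in `[0, 1]) g x| <= e.
Proof.
move=> cf cg fge.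
have -> : \int[mu]_(x in `[0, 1]) f x - \int[mu]_(x in `[0, 1]) g x =
    \int[mu]_(x in `[0, 1]) (f x + -1 * g x) - 0.
  rewrite subr0 segment_integralD //; last by continuity.
  by rewrite segment_integralZ // mulN1r.
apply: segment_integral_dist_le; first by continuity.
by move=> x; rewrite mulN1r subr0.
Qed.

Lemma char_cos_near_fcoef (w b : nat -> R) (n : nat) (t phi h : R) (S : R -> R) :
  (forall k, w k \is a Num.int) -> (forall k, `|b k| <= h) -> h <= 1 ->
  (forall x, t * S x = \sum_(1 <= k < n.+1) b k * cos (2 * pi * w k * x)) ->
  `|char_cos S t phi - fcoef w b n 0 phi| <= (1 + 4 * h ^+ 6) ^+ n - 1.
Proof.
move=> wZ bh h1 St.
have cy k : continuous (fun x => b k * cos (2 * pi * w k * x)) by continuity.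
rewrite -(integral_phased_prod b n phi wZ (rpred0 _)) distrC.
apply: segment_integral_dist.
- by apply: (continuous_phased_prod (y := fun k x => _)) => //; continuity.
- have -> : (fun x => cos (t * S x + phi)) =
      (fun x => cos (\sum_(1 <= k < n.+1) b k * cos (2 * pi * w k * x) + phi)).
    by apply/funext => x; rewrite St.
  apply: continuous_fun_cos; apply: continuous_fun_add; last by continuity.
  exact: continuous_fun_sum.
move=> x; rewrite mulr0 mul0r add0r St.
set Y := \sum_(_ <= _ < _) _.
have := @phased_prod_near_cos _ (fun k => b k * cos (2 * pi * w k * x)) h n (Y + phi).
rewrite -/Y (addrAC Y) subrr add0r; apply => // k.
rewrite normrM -[leRHS]mulr1; apply: ler_pM => //.
by rewrite ler_norml cos_le1 cos_geN1.
Qed.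

Lemma pow1D_sub1_le (x : R) n : 0 <= x -> n%:R * x <= 1 / 2 ->
  (1 + x) ^+ n - 1 <= 2 * (n%:R * x).
Proof.
move=> x0 nx; set z := n%:R * x in nx *.
have z0 : 0 <= z by rewrite mulr_ge0.
have H1 : (1 + x) ^+ n <= expR z.
  by rewrite expRM_natl lerXn2r ?nnegrE ?expR_ge0 ?expR_ge1Dx // addr_ge0.
have H2 := expR_ge1Dx (- z).
have H3 : expR z * expR (- z) = 1 by rewrite -expRD subrr expR0.
have := expR_gt0 z; nra.
Qed.

Lemma prod_sub_expR (x : nat -> R) n : (forall k, 0 <= x k <= 1) ->
  `|\prod_(1 <= k < n.+1) (1 - x k) - expR (- \sum_(1 <= k < n.+1) x k)| <=
  \sum_(1 <= k < n.+1) x k ^+ 2.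
Proof.
move=> x01; elim: n => [|n IH].
  by rewrite !big_geq // oppr0 expR0 subrr normr0.
rewrite !(@big_nat_recr _ _ _ n.+1) //= opprD expRD.
set P := \prod_(_ <= _ < _) _ in IH *; set E := expR _ in IH *.
set z := x n.+1; have /andP[z0 z1] : 0 <= z <= 1 := x01 _.
have -> : P * (1 - z) - E * expR (- z) = (1 - z) * (P - E) + E * (1 - z - expR (- z)).
  by ring.
apply: (le_trans (ler_normD _ _)); apply: lerD.
  by rewrite normrM (le_trans _ IH) // ler_piMl // ger0_norm; lra.
have E0 : 0 <= E by exact: expR_ge0.
have E1 : E <= 1.
  by rewrite -expR0 ler_expR oppr_le0 big_nat sumr_ge0 // => k _; have /andP[] := x01 k.
rewrite normrM (ger0_norm E0) distrC.
apply: (@le_trans _ _ `|expR (- z) - (1 - z)|); first by rewrite ler_piMl.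
have H1 := expR_ge1Dx (- z); have H2 := expR_ge1Dx z.
have H3 : expR z * expR (- z) = 1 by rewrite -expRD subrr expR0.
rewrite ger0_norm; last by rewrite subr_ge0.
by have := expR_gt0 (- z); nra.
Qed.

End TrigSumCharacteristic.

Section TrigSum.
Context (R : realType).

Lemma continuous_trig_sum (m : nat -> nat) (a : nat -> nat -> R) n :
  continuous (trig_sum m a n).
Proof. by apply: continuous_fun_sum => k; continuity. Qed.

Lemma array_norm_sqr (a : nat -> nat -> R) n :
  array_norm a n ^+ 2 = 2^-1 * \sum_(1 <= k < n.+1) a k n ^+ 2.
Proof. by rewrite sqr_sqrtr // mulr_ge0 // sumr_ge0 // => k _; exact: sqr_ge0. Qed.

(** The first bound controls the characteristic function on the whole range of t,
    the second one identifies its limit. *)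
Lemma trig_sum_char (q : R) (g : nat) :
  1 < q -> (1 < g <= 4)%N -> g%:R - 2 < q ->
  exists C h0 : R, [/\ 0 <= C, 0 < h0 &
    forall (m : nat -> nat) (a : nat -> nat -> R) (n : nat) (t h : R),
      (forall k, (1 <= k)%N -> (0 < m k)%N) ->
      (forall k, (1 <= k)%N -> q <= (m k.+1)%:R / (m k)%:R) ->
      (forall k, (1 <= k <= n)%N -> `|t * a k n| <= h) ->
      h <= h0 -> h <= 1 -> 0 <= h -> 4 * (n%:R * h ^+ 6) <= 1 / 2 ->
      forall phi,
        `|char_cos (trig_sum m a n) t phi| <=
          expR (- (t * array_norm a n) ^+ 2 / 2 + n%:R * (C * h ^+ g)) +
          8 * (n%:R * h ^+ 6) /\
        `|char_cos (trig_sum m a n) t phi -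
            cos phi * expR (- (t * array_norm a n) ^+ 2 / 2)| <=
          n%:R * (C * h ^+ g) * expR (n%:R * (C * h ^+ g)) +
          n%:R * h ^+ 4 + 8 * (n%:R * h ^+ 6)].
Proof.
move=> q1 g4 gq; have [C [h0 [C0 h00 H]]] := lacunary_fcoef q1 g4 gq.
exists C, h0; split => // m a n t h m_gt0 m_gap ah hh0 h1 hge0 h6 phi.
(* The recursion starts from w 0 = 0. *)
pose w k : R := if k is j.+1 then (m k)%:R else 0.
pose b k : R := if (1 <= k <= n)%N then t * a k n else 0.
have bE k : (1 <= k < n.+1)%N -> b k = t * a k n by rewrite /b ltnS => ->.
have bh k : `|b k| <= h by rewrite /b; case: ifP => [/ah//|_]; rewrite normr0.
have wZ k : w k \is a Num.int by case: k => [|k]; rewrite /w ?rpred0 ?rpred_nat.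
have w_gt0 k : 0 < w k.+1 by rewrite ltr0n m_gt0.
have w_gap k : q * w k <= w k.+1.
  case: k => [|k]; first by rewrite mulr0 ltW.
  by rewrite -ler_pdivlMr // m_gap.
have St x : t * trig_sum m a n x = \sum_(1 <= k < n.+1) b k * cos (2 * pi * w k * x).
  rewrite mulr_sumr !big_nat; apply: eq_bigr => -[//|k] kn.
  by rewrite bE // mulrA.
have Sb : \sum_(1 <= k < n.+1) b k ^+ 2 = 2 * (t * array_norm a n) ^+ 2.
  rewrite exprMn array_norm_sqr.
  rewrite (_ : 2 * _ = t ^+ 2 * \sum_(1 <= k < n.+1) a k n ^+ 2); last by field.
  rewrite mulr_sumr.
  by rewrite !big_nat; apply: eq_bigr => k kn; rewrite bE // exprMn.
have [F1 F2] := H w b h n erefl w_gt0 w_gap bh hh0 phi.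
have near : `|char_cos (trig_sum m a n) t phi - fcoef w b n 0 phi| <= 8 * (n%:R * h ^+ 6).
  apply: (le_trans (char_cos_near_fcoef phi wZ bh h1 St)).
  have -> : 8 * (n%:R * h ^+ 6) = 2 * (n%:R * (4 * h ^+ 6)) by ring.
  apply: pow1D_sub1_le; first by rewrite mulr_ge0 // exprn_ge0.
  by rewrite mulrCA.
have Eb : - (\sum_(1 <= k < n.+1) b k ^+ 2) / 4 = - (t * array_norm a n) ^+ 2 / 2.
  by rewrite Sb; field.
rewrite Eb in F1.
split.
  rewrite -[X in `|X|](subrK (fcoef w b n 0 phi)) addrC.
  by apply: (le_trans (ler_normD _ _)); exact: lerD.
set X := char_cos _ _ _ in near *; set F := fcoef w b n 0 phi in F1 F2 near *.
set P := \prod_(_ <= _ < _) _ in F2; set G := expR (- _ / 2).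
have PG : `|P - G| <= n%:R * h ^+ 4.
  pose x k := b k ^+ 2 / 4.
  have hb k : b k ^+ 2 <= h ^+ 2.
    by rewrite -[b k ^+ 2]ger0_norm ?sqr_ge0 // normrX lerXn2r // nnegrE.
  have h2 : h ^+ 2 <= 1 by rewrite exprn_ile1.
  have x01 k : 0 <= x k <= 1.
    have b0 := sqr_ge0 (b k); have := hb k.
    by rewrite /x => hbk; apply/andP; split; lra.
  have := prod_sub_expR n x01.
  rewrite -mulr_suml -mulNr Eb -/P -/G => /le_trans; apply.
  rewrite big_nat; apply: (@le_trans _ _ (\sum_(1 <= k < n.+1) h ^+ 4)).
    rewrite !big_nat; apply: ler_sum => k _.
    have xh : x k <= h ^+ 2 by have := hb k; have := sqr_ge0 h; rewrite /x; lra.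
    have /andP[x0 _] := x01 k.
    by rewrite (exprM h 2 2) lerXn2r // nnegrE (le_trans x0).
  by rewrite sumr_const_nat subn1 /= -[_ *+ n]mulr_natl.
have -> : X - cos phi * G = (F - cos phi * P) + cos phi * (P - G) + (X - F) by ring.
apply: (le_trans (ler_normD _ _)); apply: lerD => //.
apply: (le_trans (ler_normD _ _)); apply: lerD => //.
rewrite normrM; apply: (le_trans _ PG); rewrite ler_piMl //.
by rewrite ler_norml cos_le1 cos_geN1.
Qed.

End TrigSum.

(** * Asymptotics of the characteristic function *)

Section TrigSumAsymptotics.
Context (R : realType).
Implicit Types (a : nat -> nat -> R).

Lemma array_max_ge0 a n : 0 <= array_max a n.
Proof. by rewrite /array_max bigmax_idl le_max lexx. Qed.

Lemma le_array_max a n k : (1 <= k <= n)%N -> `|a k n| <= array_max a n.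
Proof.
move=> kn; apply: (@le_bigmax_seq _ _ _ _ _ k xpredT (fun k => `|a k n|)) => //.
by rewrite mem_index_iota ltnS.
Qed.

(** With t bounded, this bounds (t A_n)^2 by n h^2 up to a constant. *)
Lemma array_norm_le a n : array_norm a n ^+ 2 <= n%:R * array_max a n ^+ 2.
Proof.
rewrite array_norm_sqr.
have : \sum_(1 <= k < n.+1) a k n ^+ 2 <= \sum_(1 <= k < n.+1) array_max a n ^+ 2.
  rewrite !big_nat; apply: ler_sum => k kn.
  rewrite -[a k n ^+ 2]ger0_norm ?sqr_ge0 // normrX.
  by rewrite lerXn2r ?nnegrE ?array_max_ge0 // le_array_max.
rewrite sumr_const_nat subn1 /= -[_ *+ n]mulr_natl.
have : 0 <= \sum_(1 <= k < n.+1) a k n ^+ 2 by apply: sumr_ge0 => k _; exact: sqr_ge0.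
by lra.
Qed.

Lemma powR_nat_ge (eps : R) n : 0 < eps -> n%:R <= n%:R `^ (1 + eps) :> R.
Proof.
case: n => [|n] e0; first by rewrite powR_ge0.
rewrite -[leLHS]powRr1 ?ler0n //; apply: ler_powR; first by rewrite ler1n.
by rewrite lerDl ltW.
Qed.

(** The exponent g is the length of the shortest possible resonance between
    frequencies; it depends only on whether q exceeds 2. *)
Lemma growth_exponent (q : R) a :
  1 < q ->
  (exists eps : R, [/\ 0 < eps,
    q <= 2 ->
      (n%:R `^ (1 + eps)) * array_max a n ^+ 3 @[n --> \oo] --> (0 : R) &
    2 < q ->
      (n%:R `^ (1 + eps)) * array_max a n ^+ 4 @[n --> \oo] --> (0 : R)]) ->
  exists g, [/\ (1 < g <= 4)%N, g%:R - 2 < q &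
    n%:R * array_max a n ^+ g @[n --> \oo] --> (0 : R)].
Proof.
move=> q1 [eps [e0 H3 H4]].
have key g : (n%:R `^ (1 + eps)) * array_max a n ^+ g @[n --> \oo] --> (0 : R) ->
    n%:R * array_max a n ^+ g @[n --> \oo] --> (0 : R).
  apply: squeeze_cvgr; last exact: cvg_cst.
  near=> n; have dg : 0 <= array_max a n ^+ g by rewrite exprn_ge0 // array_max_ge0.
  by rewrite mulr_ge0 //= ler_wpM2r // powR_nat_ge.
have [q2|q2] := leP q 2.
  by exists 3%N; split => //; [lra|exact/key/H3].
by exists 4%N; split => //; [lra|exact/key/H4].
Unshelve. all: by end_near. Qed.

Lemma scaled_cvg0 (c : R) (X : nat -> R) : X n @[n --> \oo] --> (0 : R) ->
  c * X n @[n --> \oo] --> (0 : R).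
Proof. by move=> X0; rewrite -(mulr0 c); apply: cvgMr; exact: X0. Qed.

Section Rates.
Context (d : nat -> R) (g : nat).
Hypothesis d0 : forall n, 0 <= d n.
Hypothesis g14 : (1 < g <= 4)%N.
Hypothesis dg : n%:R * d n ^+ g @[n --> \oo] --> (0 : R).

Lemma rate_cvg0 : d n @[n --> \oo] --> (0 : R).
Proof.
have g0 : (0 < g)%N by case/andP: g14 => /ltnW.
apply/cvgr0Pnorm_le => e e0.
have eg : 0 < e ^+ g by exact: exprn_gt0.
have H : \forall n \near \oo, `|n%:R * d n ^+ g| <= e ^+ g.
  by move/cvgr0_norm_le: dg; apply.
near=> n; rewrite ger0_norm //.
have n1 : (1 <= n)%N by near: n; exact: nbhs_infty_ge.
have : `|n%:R * d n ^+ g| <= e ^+ g by near: n.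
have dn0 : 0 <= d n ^+ g by exact: exprn_ge0.
rewrite ger0_norm ?mulr_ge0 // => ndg.
have : d n ^+ g <= e ^+ g by apply: le_trans ndg; rewrite ler_peMl // ler1n.
by rewrite ler_pXn2r // nnegrE // ltW.
Unshelve. all: by end_near. Qed.

Lemma rate_pow_cvg0 k : (g <= k)%N -> n%:R * d n ^+ k @[n --> \oo] --> (0 : R).
Proof.
move=> gk; apply: squeeze_cvgr dg; last exact: cvg_cst.
near=> n; rewrite mulr_ge0 ?exprn_ge0 //= ler_wpM2l //.
apply: ler_wiXn2l => //.
have : `|d n| <= 1 by near: n; move/cvgr0_norm_le: rate_cvg0; apply.
by rewrite ger0_norm.
Unshelve. all: by end_near. Qed.

End Rates.

Section Limits.
Context (q : R) (m : nat -> nat) (a : nat -> nat -> R) (g : nat).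
Hypothesis q1 : 1 < q.
Hypothesis m_gt0 : forall k, (1 <= k)%N -> (0 < m k)%N.
Hypothesis m_gap : forall k, (1 <= k)%N -> q <= (m k.+1)%:R / (m k)%:R.
Hypothesis A_cvg : array_norm a n @[n --> \oo] --> +oo.
Hypothesis g4 : (1 < g <= 4)%N.
Hypothesis gq : g%:R - 2 < q.
Hypothesis dg : n%:R * array_max a n ^+ g @[n --> \oo] --> (0 : R).

Let A := array_norm a.
Let d := array_max a.

Let d_cvg0 : d n @[n --> \oo] --> (0 : R).
Proof. exact: rate_cvg0 (array_max_ge0 a) g4 dg. Qed.

(** The Gaussian part is at most a multiple of 1 / (1 + s^2).  So is the truncation
    error n h^6 on the range s <= T A_n, because s^2 n h^6 <= (n h^4)^2 there and
    n h^4 tends to 0. *)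
Lemma trig_sum_char_dominated (T : R) : 0 < T -> exists M : R,
  \forall n \near \oo, forall s phi : R, 0 <= s <= T * A n ->
    `|char_cos (trig_sum m a n) (s / A n) phi| <= M / (1 + s ^+ 2).
Proof.
move=> T0; have [C [h0 [C0 h00 H]]] := trig_sum_char q1 g4 gq.
have /andP[_ g_le4] := g4.
exists (2 * expR 1 + 1).
have small e (X : nat -> R) : 0 < e -> X n @[n --> \oo] --> (0 : R) ->
    \forall n \near \oo, X n <= e.
  move=> e0 /cvgr0_norm_le /(_ _ e0); apply: filterS => n.
  exact: le_trans (ler_norm _).
have Hg := scaled_cvg0 (C * T ^+ g) dg.
have H4 := scaled_cvg0 (T ^+ 4) (rate_pow_cvg0 (array_max_ge0 a) g4 dg g_le4).
have Hd := scaled_cvg0 T d_cvg0.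
near=> n => s phi /andP[s0 sT].
have A1 : 1 <= A n by near: n; move/cvgryPge: A_cvg; apply.
have A0 : 0 < A n by apply: lt_le_trans A1.
have hh0 : T * d n <= h0 by near: n; exact: (small _ _ h00 Hd).
have h1 : T * d n <= 1 by near: n; exact: (small 1 _ ltr01 Hd).
have nh4 : n%:R * (T * d n) ^+ 4 <= 1 / 16.
  by rewrite exprMn mulrCA; near: n; apply: (small _ _ _ H4); lra.
have nhg : n%:R * (C * (T * d n) ^+ g) <= 1.
  have -> : n%:R * (C * (T * d n) ^+ g) = C * T ^+ g * (n%:R * d n ^+ g).
    by rewrite exprMn; ring.
  by near: n; exact: (small 1 _ ltr01 Hg).
have dn0 : 0 <= d n by exact: array_max_ge0.
have hge0 : 0 <= T * d n by rewrite mulr_ge0 // ltW.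
set h := T * d n in hh0 h1 nh4 nhg hge0.
have nh40 : 0 <= n%:R * h ^+ 4 by rewrite mulr_ge0 ?exprn_ge0.
have h2 : 0 <= h ^+ 2 <= 1 by rewrite exprn_ge0 // exprn_ile1.
have nh6 : n%:R * h ^+ 6 = n%:R * h ^+ 4 * h ^+ 2 by rewrite -mulrA -exprD.
have nh6le : n%:R * h ^+ 6 <= n%:R * h ^+ 4.
  by rewrite nh6 ler_piMr //; case/andP: h2.
have nh60 : 0 <= n%:R * h ^+ 6 by rewrite mulr_ge0 ?exprn_ge0.
have ah k : (1 <= k <= n)%N -> `|s / A n * a k n| <= h.
  move=> kn; rewrite normrM; apply: ler_pM => //; last exact: le_array_max.
  by rewrite ger0_norm ?divr_ge0 ?ler_pdivrMr // ltW.
have h6 : 4 * (n%:R * h ^+ 6) <= 1 / 2 by lra.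
have [+ _] := H m a n (s / A n) h m_gt0 m_gap ah hh0 h1 hge0 h6 phi.
rewrite -/(A n) mulfVK ?gt_eqF // => /le_trans; apply.
have s2 := sqr_ge0 s.
rewrite ler_pdivlMr; last by lra.
rewrite mulrDl; apply: lerD.
  apply: (@le_trans _ _ (expR 1 * expR (- s ^+ 2 / 2) * (1 + s ^+ 2))).
    by rewrite ler_wpM2r; [|lra|rewrite -expRD ler_expR; lra].
  have e1 := expR_gt0 (1 : R).
  rewrite -mulrA [2 * _]mulrC ler_wpM2l // ?ltW //.
  have G1 := expR_ge1Dx (s ^+ 2 / 2).
  have G2 : expR (- s ^+ 2 / 2) * expR (s ^+ 2 / 2) = 1.
    by rewrite -expRD mulNr addNr expR0.
  have G3 := expR_gt0 (- s ^+ 2 / 2).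
  nra.
have snh : s ^+ 2 * (n%:R * h ^+ 6) <= (n%:R * h ^+ 4) ^+ 2.
  have sT2 : s ^+ 2 <= n%:R * h ^+ 2.
    apply: (@le_trans _ _ ((T * A n) ^+ 2)).
      by rewrite lerXn2r // nnegrE // (le_trans s0).
    rewrite /h !exprMn [leRHS]mulrCA ler_wpM2l ?exprn_ge0 ?(ltW T0) //.
    exact: array_norm_le.
  apply: (@le_trans _ _ (n%:R * h ^+ 2 * (n%:R * h ^+ 6))).
    by rewrite ler_wpM2r.
  by rewrite le_eqVlt; apply/orP; left; apply/eqP; ring.
have : (n%:R * h ^+ 4) ^+ 2 <= n%:R * h ^+ 4 by rewrite expr2 ler_piMr //; lra.
by lra.
Unshelve. all: by end_near. Qed.

(** The phase - (s / A_n) u centres the sum at u; it disappears in the limit. *)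
Lemma trig_sum_char_limit (s u : R) : 0 <= s ->
  char_cos (trig_sum m a n) (s / A n) (- (s / A n * u)) @[n --> \oo] -->
  expR (- s ^+ 2 / 2).
Proof.
move=> s0; have [C [h0 [C0 h00 H]]] := trig_sum_char q1 g4 gq.
have /andP[_ g_le4] := g4.
have d4 := rate_pow_cvg0 (array_max_ge0 a) g4 dg g_le4.
have d6 : n%:R * d n ^+ 6 @[n --> \oo] --> (0 : R).
  by apply: (rate_pow_cvg0 (array_max_ge0 a) g4 dg); apply: leq_trans g_le4 _.
pose r n : R := n%:R * (C * d n ^+ g) * expR (n%:R * (C * d n ^+ g)) +
  n%:R * d n ^+ 4 + 8 * (n%:R * d n ^+ 6).
have Cg : n%:R * (C * d n ^+ g) @[n --> \oo] --> (0 : R).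
  by under eq_cvg do rewrite mulrCA; exact: scaled_cvg0.
have r0 : r n @[n --> \oo] --> (0 : R).
  rewrite [X in _ --> X](_ : 0 = 0 * expR 0 + 0 + 0); last by ring.
  apply: cvgD; [apply: cvgD => //|exact: scaled_cvg0].
  apply: cvgM => //; apply: continuous_cvg => //; exact: continuous_expR.
have phi0 : cos (- (s / A n * u)) * expR (- s ^+ 2 / 2) @[n --> \oo] -->
    expR (- s ^+ 2 / 2).
  rewrite -[X in _ --> X]mul1r -cos0; apply: cvgMl.
  apply: continuous_cvg; first exact: continuous_cos.
  rewrite -[X in _ --> X]oppr0; apply: cvgN.
  rewrite -(mul0r u); apply: cvgMl; apply: scaled_cvg0.
  by apply/gtr0_cvgV0 => //; near=> n; near: n; move/cvgryPgt: A_cvg; apply.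
rewrite -[X in _ --> X]add0r.
have diff0 : char_cos (trig_sum m a n) (s / A n) (- (s / A n * u)) -
    cos (- (s / A n * u)) * expR (- s ^+ 2 / 2) @[n --> \oo] --> (0 : R).
  apply/norm_cvg0P; apply: squeeze_cvgr r0; last exact: cvg_cst.
  near=> n; rewrite normr_ge0 /=.
  have A1 : s + 1 <= A n by near: n; move/cvgryPge: A_cvg; apply.
  have A0 : 0 < A n by apply: lt_le_trans A1; lra.
  have dn0 : 0 <= d n by exact: array_max_ge0.
  have dh0 : `|d n| <= h0 by near: n; move/cvgr0_norm_le: d_cvg0; apply.
  have dh1 : `|d n| <= 1 by near: n; move/cvgr0_norm_le: d_cvg0; apply.
  have d6n : `|n%:R * d n ^+ 6| <= 1 / 8.
    by near: n; move/cvgr0_norm_le: d6; apply; lra.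
  rewrite ger0_norm // in dh0; rewrite ger0_norm // in dh1.
  rewrite ger0_norm ?mulr_ge0 ?exprn_ge0 // in d6n.
  have ah k : (1 <= k <= n)%N -> `|s / A n * a k n| <= d n.
    move=> kn; rewrite normrM -[leRHS]mul1r; apply: ler_pM => //.
      by rewrite ger0_norm ?divr_ge0 ?ler_pdivrMr ?mul1r // ?ltW //; lra.
    exact: le_array_max.
  have h6 : 4 * (n%:R * d n ^+ 6) <= 1 / 2 by lra.
  have [_] := H m a n (s / A n) (d n) m_gt0 m_gap ah dh0 dh1 dn0 h6 (- (s / A n * u)).
  by rewrite -/(A n) mulfVK ?gt_eqF.
rewrite (_ : (fun n => char_cos _ _ _) = (fun n =>
  (char_cos (trig_sum m a n) (s / A n) (- (s / A n * u)) -
    cos (- (s / A n * u)) * expR (- s ^+ 2 / 2)) +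
  cos (- (s / A n * u)) * expR (- s ^+ 2 / 2))).
  exact: cvgD diff0 phi0.
by apply/funext => n; rewrite subrK.
Unshelve. all: by end_near. Qed.

End Limits.
End TrigSumAsymptotics.

(** * Exchange of integrals on a rectangle *)

Section FubiniRectangle.
Context (R : realType).
Local Notation mu := (@lebesgue_measure R).
Local Notation mR := (measurableTypeR R).
Lemma segment_measure_lty (u v : R) : (mu `[u, v]%classic < +oo)%E.
Proof. by rewrite lebesgue_measure_itv /=; case: ifP => _; rewrite ?ltry // -EFinB ltry. Qed.

Context (f : mR * mR -> R) (a b c d M : R).
Hypothesis mf : measurable_fun setT f.
Hypothesis fM : forall s x, s \in `[a, b] -> x \in `[c, d] -> `|f (s, x)| <= M.

Let D : set (mR * mR) := `[a, b]%classic `*` `[c, d]%classic.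
Let mD : measurable D.
Proof. by apply: measurableX; exact: measurable_itv. Qed.

Let integrable_f : (mu \x mu)%E.-integrable D (EFin \o f).
Proof.
apply: measurable_bounded_integrable => //.
- apply: (@le_lt_trans _ _ (mu `[a, b]%classic * mu `[c, d]%classic)%E).
    by rewrite le_eqVlt; apply/orP; left; apply/eqP; exact: product_measure1E.
  by rewrite lte_mul_pinfty ?segment_measure_lty // ge0_fin_numE ?segment_measure_lty.
- exact: measurable_funTS.
exists M; split; first exact: num_real.
by move=> N MN [s x] [/= Ds Dx]; apply: le_trans (ltW MN); exact: fM.
Qed.

Let integrable_g : (mu \x mu)%E.-integrable setT (EFin \o (f \_ D)).
Proof. by rewrite -restrict_EFin; apply/integrable_restrict => //; rewrite setTI. Qed.

Lemma integrable_section1 s : s \in `[a, b] ->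
  mu.-integrable `[c, d] (EFin \o (fun x => f (s, x))).
Proof.
move=> sab; apply: measurable_bounded_integrable => //.
- exact: segment_measure_lty.
- apply: measurable_funTS; apply: measurableT_comp mf _; exact: measurable_pair1.
exists M; split; first exact: num_real.
by move=> N MN x /= Dx; apply: le_trans (ltW MN); exact: fM.
Qed.

Lemma integrable_section2 x : x \in `[c, d] ->
  mu.-integrable `[a, b] (EFin \o (fun s => f (s, x))).
Proof.
move=> xcd; apply: measurable_bounded_integrable => //.
- exact: segment_measure_lty.
- apply: measurable_funTS; apply: measurableT_comp mf _; exact: measurable_pair2.
exists M; split; first exact: num_real.
by move=> N MN s /= Ds; apply: le_trans (ltW MN); exact: fM.
Qed.

Let section1E s : (\int[mu]_x ((EFin \o (f \_ D)) (s, x)) =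
  (((fun s => \int[mu]_(x in `[c, d]) f (s, x)) \_ `[a, b]) s)%:E)%E.
Proof.
rewrite /patch; case: ifPn => [sab|sab].
  rewrite inE /= in sab.
  rewrite fineK ?integrable_fin_num //; last exact: integrable_section1.
  rewrite [RHS]integral_mkcond; apply: eq_integral => x _.
  rewrite /patch /=; have [xcd|xcd] := boolP (x \in `[c, d]%classic).
    by rewrite ifT // inE; split => //=; rewrite inE in xcd.
  rewrite ifF //; apply/negbTE; apply: contra xcd; rewrite !inE.
  by case.
rewrite integral0_eq // => x _ /=; rewrite ifF //; apply/negbTE.
by apply: contra sab; rewrite !inE; case.
Qed.

Let section2E x : (\int[mu]_s ((EFin \o (f \_ D)) (s, x)) =
  (((fun x => \int[mu]_(s in `[a, b]) f (s, x)) \_ `[c, d]) x)%:E)%E.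
Proof.
rewrite /patch; case: ifPn => [xcd|xcd].
  rewrite inE /= in xcd.
  rewrite fineK ?integrable_fin_num //; last exact: integrable_section2.
  rewrite [RHS]integral_mkcond; apply: eq_integral => s _.
  rewrite /patch /=; have [sab|sab] := boolP (s \in `[a, b]%classic).
    by rewrite ifT // inE; split => //=; rewrite inE in sab.
  rewrite ifF //; apply/negbTE; apply: contra sab; rewrite !inE.
  by case.
rewrite integral0_eq // => s _ /=; rewrite ifF //; apply/negbTE.
by apply: contra xcd; rewrite !inE; case.
Qed.

Lemma measurable_section_integral : measurable_fun setT
  ((fun s => \int[mu]_(x in `[c, d]) f (s, x)) \_ `[a, b]).
Proof.
apply/measurable_EFinP; have := measurable_fubini_F integrable_g.
by rewrite /fubini_F; under eq_fun do rewrite section1E.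
Qed.

Lemma Rintegral_fubini :
  \int[mu]_(s in `[a, b]) \int[mu]_(x in `[c, d]) f (s, x) =
  \int[mu]_(x in `[c, d]) \int[mu]_(s in `[a, b]) f (s, x).
Proof.
rewrite [LHS]Rintegral_mkcond [RHS]Rintegral_mkcond /Rintegral.
transitivity (fine (\int[mu]_s \int[mu]_x ((EFin \o (f \_ D)) (s, x)))%E).
  by congr fine; apply: eq_integral => s _; rewrite section1E.
rewrite Fubini //; congr fine; apply: eq_integral => x _; exact: section2E.
Qed.

End FubiniRectangle.

(** * The Fejer kernel *)

Section FejerKernel.
Context (R : realType).
Implicit Types x z : R.
Local Notation mu := (@lebesgue_measure R).

(** The square of the sine quotient sin (x/2) / (x/2), extended by continuity. *)
Definition fejer x : R := if x == 0 then 1 else 2 * (1 - cos x) / x ^+ 2.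

Lemma fejer_sqr x : fejer x * x ^+ 2 = 2 * (1 - cos x).
Proof.
rewrite /fejer; case: eqP => [->|/eqP x0]; first by rewrite cos0; ring.
by rewrite mulfVK // sqrf_eq0.
Qed.

Lemma fejer_ge0 x : 0 <= fejer x.
Proof.
rewrite /fejer; case: ifP => // _.
by rewrite divr_ge0 ?sqr_ge0 // mulr_ge0 // subr_ge0 cos_le1.
Qed.

Lemma fejer_le1 x : fejer x <= 1.
Proof.
rewrite /fejer; case: eqP => // /eqP x0.
rewrite ler_pdivrMr ?mul1r ?exprn_even_gt0 //.
by have := cos_ge_taylor2 x; lra.
Qed.

Lemma fejer_ge_quadratic x : 1 - x ^+ 2 / 12 <= fejer x.
Proof.
rewrite /fejer; case: eqP => [->|/eqP x0]; first by lra.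
rewrite ler_pdivlMr ?exprn_even_gt0 //.
by have := cos_le_taylor4 x; rewrite /cos_taylor; lra.
Qed.

Lemma fejer_even x : fejer (- x) = fejer x.
Proof. by rewrite /fejer oppr_eq0 cosN sqrrN. Qed.

Lemma fejer_le_sqrV x : x != 0 -> fejer x <= 4 / x ^+ 2.
Proof.
move=> x0; rewrite ler_pdivlMr ?exprn_even_gt0 // fejer_sqr.
by have := cos_geN1 x; lra.
Qed.

(** The zeros of one kernel fall on the peaks of the other one, so two translates
    together dominate the decay of order 1 / x^2. *)
Lemma fejer_sum_ge x : 2 / (x ^+ 2 + pi ^+ 2) <= fejer x + fejer (x - pi).
Proof.
have p0 : 0 < (pi : R) ^+ 2 by rewrite exprn_gt0 // pi_gt0.
have x2 := sqr_ge0 x.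
have H1 := fejer_sqr x; have H2 := fejer_sqr (x - pi).
have c : cos (x - pi) = - cos x by rewrite cosB cospi sinpi; ring.
rewrite c opprK in H2.
have F1 := fejer_ge0 x; have F2 := fejer_ge0 (x - pi).
rewrite ler_pdivrMr; last by lra.
have B1 : fejer x * x ^+ 2 <= fejer x * (2 * (x ^+ 2 + pi ^+ 2)).
  by rewrite ler_wpM2l //; lra.
have B2 : fejer (x - pi) * (x - pi) ^+ 2 <= fejer (x - pi) * (2 * (x ^+ 2 + pi ^+ 2)).
  rewrite ler_wpM2l //; have := sqr_ge0 (x + pi).
  by rewrite -subr_ge0 => H; rewrite -subr_ge0; move: H; congr (0 <= _); ring.
by lra.
Qed.

Lemma continuous_fejer : continuous fejer.
Proof.
move=> x; have [->|x0] := eqVneq x 0.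
  rewrite /continuous_at /fejer eqxx -/(fejer _).
  apply: (@squeeze_cvgr _ _ _ _ (fun z : R => 1 - z ^+ 2 / 12) (fun=> 1)).
  - by near=> z; rewrite fejer_ge_quadratic fejer_le1.
  - have : continuous (fun z : R => 1 - z ^+ 2 / 12) by continuity.
    by move/(_ 0); rewrite /continuous_at expr0n /= mul0r subr0.
  - exact: cvg_cst.
rewrite /continuous_at (_ : fejer x = 2 * (1 - cos x) / x ^+ 2); last first.
  by rewrite /fejer (negbTE x0).
apply: (@cvg_trans _ (2 * (1 - cos z) / z ^+ 2 @[z --> x])).
  apply: near_eq_cvg; near=> z.
  have z0 : z != 0 by near: z; apply: (cvgr_neq0 x).
  by rewrite /fejer (negbTE z0).
have c1 : continuous (fun z : R => 2 * (1 - cos z)) by continuity.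
have c2 : continuous (fun z : R => z ^+ 2) by continuity.
have c3 : (z ^+ 2)^-1 @[z --> x] --> (x ^+ 2)^-1.
  apply: (continuous_comp (c2 x)).
  by apply: inv_continuous; rewrite sqrf_eq0.
exact: (cvgM (c1 x) c3).
Unshelve. all: by end_near. Qed.

Lemma continuous_fun_fejer (f : R -> R) : continuous f ->
  continuous (fun x => fejer (f x)).
Proof. by move=> cf x; apply: continuous_comp; [exact: cf|exact: continuous_fejer]. Qed.

(** The Fourier transform of the kernel is a tent with compact support.  The
    integral is written in the scaled variable s = A t, so that the averages
    below need no change of variables. *)
Lemma fejer_scaled_integral (A T z : R) : 0 < A -> 0 < T ->
  \int[mu]_(s in `[0, T * A]) (2 / T * (1 - s / (T * A)) * cos (s / A * z)) =
  A * fejer (T * z).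
Proof.
move=> A0 T0; have TA0 : 0 < T * A by exact: mulr_gt0.
have An0 : A != 0 by rewrite gt_eqF.
have Tn0 : T != 0 by rewrite gt_eqF.
have [->|z0] := eqVneq z 0.
  rewrite mulr0 /fejer eqxx mulr1.
  pose F (s : R) : R := 2 / T * (s - s ^+ 2 / (2 * (T * A))).
  have dF (s : R) : is_derive s (1 : R) F (2 / T * (1 - s / (T * A)) * cos (s / A * 0)).
    by rewrite /F; compute_derive; rewrite ?(mulr0, cos0); field; rewrite ?An0 ?Tn0.
  rewrite (segment_FTC TA0 _ dF); last by continuity.
  by rewrite /F; field; rewrite An0.
pose c : R := z / A.
pose F (s : R) : R := 2 / T * ((1 - s / (T * A)) * (sin (s / A * z) / c) -
   cos (s / A * z) / ((T * A) * c ^+ 2)).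
have dF (s : R) : is_derive s (1 : R) F (2 / T * (1 - s / (T * A)) * cos (s / A * z)).
  by rewrite /F /c; compute_derive; field; rewrite An0 Tn0.
rewrite (segment_FTC TA0 _ dF); last by continuity.
rewrite /F /fejer mulf_eq0 (negbTE Tn0) (negbTE z0) /= !mul0r cos0 sin0.
rewrite (_ : T * A / A * z = T * z); last by field.
by rewrite /c; field; rewrite An0 Tn0 z0.
Qed.

End FejerKernel.

Section FejerPrimitive.
Context (R : realType).
Implicit Types x z : R.
Local Notation mu := (@lebesgue_measure R).

Lemma integrable_oneDsqrV (c : R) :
  mu.-integrable setT (EFin \o (fun x => c / (1 + x ^+ 2))).
Proof.
have mV : measurable_fun setT (fun x : R => (1 + x ^+ 2)^-1).
  by apply: continuous_measurable_fun; exact: continuous_oneDsqrV.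
suff H : mu.-integrable setT (EFin \o (fun x => (1 + x ^+ 2)^-1)).
  have := integrableZl measurableT c H.
  by apply: eq_integrable => // x _.
apply/integrableP; split; first exact/measurable_EFinP.
under eq_integral => x _ do rewrite /= ger0_norm ?invr_ge0 ?addr_ge0 ?sqr_ge0 //.
rewrite (@ge0_symfun_integralT _ (fun x => (1 + x ^+ 2)^-1)).
- rewrite (_ : [set x | _] = `[0, +oo[%classic); last first.
    by apply/seteqP; split => x /=; rewrite in_itv /= andbT.
  by rewrite (integral0y_oneDsqr R) -EFinM ltry.
- by move=> x; rewrite invr_ge0 addr_ge0 ?sqr_ge0.
- exact: continuous_oneDsqrV.
- by move=> x /=; rewrite sqrrN.
Qed.

Lemma fejer_le_oneDsqrV x : fejer x <= 5 / (1 + x ^+ 2).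
Proof.
have x2 := sqr_ge0 x; rewrite ler_pdivlMr; last by lra.
rewrite mulrDr mulr1 fejer_sqr.
by have := fejer_le1 x; have := cos_geN1 x; lra.
Qed.

Let integrable_fejer (u : R) : mu.-integrable `]-oo, u] (EFin \o @fejer R).
Proof.
apply: (@integrableS _ _ _ mu setT) => //.
apply: (le_integrable _ _ _ (integrable_oneDsqrV 5)) => //.
  by apply/measurable_EFinP; apply: continuous_measurable_fun; exact: continuous_fejer.
move=> x _ /=; rewrite lee_fin ger0_norm ?fejer_ge0 //.
apply: le_trans (ler_norm _); exact: fejer_le_oneDsqrV.
Qed.

(** The integrals start at -oo so that the primitive is differentiable on the
    whole line; it is normalised to vanish at 0. *)
Definition fejer_primitive x : R :=
  \int[mu]_(t in `]-oo, x]) fejer t - \int[mu]_(t in `]-oo, 0]) fejer t.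

Local Notation Psi := fejer_primitive.

Lemma is_derive_fejer_primitive x : is_derive x (1 : R) Psi (fejer x).
Proof.
pose G (y : R) := \int[mu]_(t in `]-oo, y]) fejer t.
have [dF F'] : derivable G x 1 /\ derive1 G x = fejer x.
  apply: (@continuous_FTC1 _ _ -oo%O x (x + 1)).
  - by rewrite ltrDl.
  - exact: integrable_fejer.
  - by rewrite ltNyr.
  - exact: continuous_fejer.
rewrite derive1E in F'.
have H : is_derive x (1 : R) G (fejer x) by split.
have -> : fejer x = fejer x + 0 by rewrite addr0.
by apply: is_derive_fun_add => //; exact: is_derive_fun_cst.
Qed.

Lemma continuous_fun_fejer_primitive (f : R -> R) : continuous f ->
  continuous (fun x => Psi (f x)).
Proof.
move=> cf x; apply: continuous_comp; first exact: cf.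
apply/differentiable_continuous/derivable1_diffP.
by have := is_derive_fejer_primitive (f x) => ?; exact: ex_derive.
Qed.

Lemma is_derive_fejer_primitive_comp (f : R -> R) x df :
  is_derive x (1 : R) f df ->
  is_derive x (1 : R) (fun z => Psi (f z)) (fejer (f x) * df).
Proof.
by move=> hf; exact: (is_derive1_comp (is_derive_fejer_primitive _) hf).
Qed.

Let Psi0 : Psi 0 = 0. Proof. exact: subrr. Qed.

Let fejer_integral (a b : R) : a < b ->
  \int[mu]_(t in `[a, b]) fejer t = Psi b - Psi a.
Proof.
move=> ab; apply: segment_FTC => //; first exact: continuous_fejer.
exact: is_derive_fejer_primitive.
Qed.

Lemma fejer_primitive_ndecr : {homo Psi : x y / x <= y}.
Proof.
move=> x y; rewrite le_eqVlt => /predU1P[->//|xy].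
by rewrite -subr_ge0 -fejer_integral // Rintegral_ge0 // => t _; exact: fejer_ge0.
Qed.

Lemma fejer_primitive_odd x : Psi (- x) = - Psi x.
Proof.
have dS z : is_derive z (1 : R) (fun y => Psi y + Psi (- y)) 0.
  have -> : 0 = fejer z + fejer (- z) * - 1 :> R by rewrite fejer_even mulrN1 subrr.
  apply: is_derive_fun_add; first exact: is_derive_fejer_primitive.
  exact: is_derive_fejer_primitive_comp.
have := is_derive_0_is_cst x 0 dS.
by rewrite oppr0 Psi0 addr0 => /eqP; rewrite addr_eq0 => /eqP ->; rewrite opprK.
Qed.

Let is_derive_fun_inv (f : R -> R) x df : f x != 0 ->
  is_derive x (1 : R) f df ->
  is_derive x (1 : R) (fun z => (f z)^-1) (- (f x) ^- 2 * df).
Proof.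
move=> fx0 hf; split; first by apply: derivableV => //; exact: ex_derive.
by rewrite deriveV // derive_val.
Qed.

(** The derivative of fejer_primitive y + 4 / y is nonpositive for y > 0. *)
Lemma fejer_primitive_tail x z : 0 < x -> x <= z ->
  Psi z - Psi x <= 4 / x - 4 / z.
Proof.
move=> x0 xz; pose g y := - (4 * y^-1) + - Psi y.
have dg (y : R) : 0 < y -> is_derive y (1 : R) g (4 / y ^+ 2 - fejer y).
  move=> y0; have yn0 : y != 0 by rewrite gt_eqF.
  have -> : 4 / y ^+ 2 - fejer y =
      - (4 * (- y ^- 2 * 1) + y^-1 * 0) + - (fejer y * 1) by ring.
  have dV : is_derive y (1 : R) (fun z => z^-1) (- y ^- 2 * 1).
    by apply: (is_derive_fun_inv (f := fun z => z)) => //; exact: is_derive_fun_id.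
  exact: (is_derive_fun_add
    (is_derive_fun_opp (is_derive_fun_mul (is_derive_fun_cst 4 y) dV))
    (is_derive_fun_opp (is_derive_fejer_primitive_comp (is_derive_fun_id y)))).
suff : g x <= g z by rewrite /g; lra.
apply: (@ger0_derive1_ndecr _ g x z _ _ _ x z (lexx x) xz (lexx z)).
- move=> y; rewrite in_itv /= => /andP[xy _].
  by have := dg y (lt_trans x0 xy) => dgy; exact: ex_derive.
- move=> y; rewrite in_itv /= => /andP[xy _].
  have y0 := lt_trans x0 xy; have dgy := dg y y0.
  by rewrite derive1E derive_val subr_ge0 fejer_le_sqrV // gt_eqF.
- apply: derivable_within_continuous => y; rewrite in_itv /= => /andP[xy _].
  by have := dg y (lt_le_trans x0 xy) => dgy; exact: ex_derive.
Qed.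

(** The classical sums on the circle: their integrals over [0, pi] are explicit,
    and the Fejer sum of order N differs from N^2 fejer (N x) by a bounded
    amount.  This determines the total mass of the kernel. *)
Fixpoint dirichlet_sum (N : nat) x : R :=
  if N is M.+1 then dirichlet_sum M x + 2 * cos (N%:R * x) else 1.

Fixpoint fejer_sum (N : nat) x : R :=
  if N is M.+1 then fejer_sum M x + dirichlet_sum M x else 0.

Lemma dirichlet_sumE N x :
  dirichlet_sum N x * (1 - cos x) = cos (N%:R * x) - cos (N.+1%:R * x).
Proof.
elim: N => [|N IH] /=; first by rewrite mul0r mul1r cos0 mul1r.
rewrite mulrDl IH.
have e1 : cos (N.+2%:R * x) = cos (N.+1%:R * x) * cos x - sin (N.+1%:R * x) * sin x.
  by rewrite -[N.+2%:R]natr1 mulrDl mul1r cosD.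
have e2 : cos (N%:R * x) = cos (N.+1%:R * x) * cos x + sin (N.+1%:R * x) * sin x.
  rewrite (_ : N%:R * x = N.+1%:R * x - x) ?cosB //.
  by rewrite -[N.+1%:R]natr1; ring.
by rewrite e1 e2; ring.
Qed.

Lemma fejer_sumE N x : fejer_sum N x * (1 - cos x) = 1 - cos (N%:R * x).
Proof.
elim: N => [|N IH] /=; first by rewrite !mul0r cos0 subrr.
by rewrite mulrDl IH dirichlet_sumE; ring.
Qed.

Lemma fejer_sum0 N : fejer_sum N 0 = N%:R ^+ 2.
Proof.
have d0 M : dirichlet_sum M 0 = 1 + 2 * M%:R.
  elim: M => [|M IH] /=; first by ring.
  by rewrite IH mulr0 cos0 -[M.+1%:R]natr1; ring.
elim: N => [|N IH] /=; first by ring.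
by rewrite IH d0 -[N.+1%:R]natr1; ring.
Qed.

Lemma continuous_dirichlet_sum N : continuous (dirichlet_sum N).
Proof.
elim: N => [|N IH]; first exact: continuous_fun_cst.
by apply: continuous_fun_add => //; continuity.
Qed.

Lemma continuous_fejer_sum N : continuous (fejer_sum N).
Proof.
elim: N => [|N IH]; first exact: continuous_fun_cst.
by apply: continuous_fun_add => //; exact: continuous_dirichlet_sum.
Qed.

Let pi0 : 0 < pi :> R. Proof. exact: pi_gt0. Qed.

Let measure_0pi : fine (mu `[0, pi]%classic) = pi.
Proof. by rewrite lebesgue_measure_itv /= lte_fin pi0 oppr0 addr0. Qed.

Lemma dirichlet_sum_integral N : \int[mu]_(x in `[0, pi]) dirichlet_sum N x = pi.
Proof.
elim: N => [|N IH]; first by rewrite /= Rintegral_cst // measure_0pi mul1r.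
rewrite /= segment_integralD; [|exact: continuous_dirichlet_sum|by continuity].
have dF (x : R) : is_derive x (1 : R) (fun x => 2 * (N.+1%:R^-1 * sin (N.+1%:R * x)))
    (2 * cos (N.+1%:R * x)).
  by compute_derive; field.
rewrite IH (segment_FTC pi0 _ dF); last by continuity.
have s0 : sin (N.+1%:R * pi) = 0 :> R.
  elim: (N.+1) => [|M IHM]; first by rewrite mul0r sin0.
  by rewrite -natr1 mulrDl mul1r sinDpi IHM oppr0.
by rewrite s0 !mulr0 sin0 !mulr0 subrr addr0.
Qed.

Lemma fejer_sum_integral N : \int[mu]_(x in `[0, pi]) fejer_sum N x = N%:R * pi.
Proof.
elim: N => [|N IH]; first by rewrite /= Rintegral_cst // !mul0r.
rewrite /= segment_integralD; [|exact: continuous_fejer_sum|exact: continuous_dirichlet_sum].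
by rewrite IH dirichlet_sum_integral -[N.+1%:R]natr1; ring.
Qed.

(** The difference is (1 - cos (N x)) (2 / x^2 - 1 / (1 - cos x)), and the second
    factor stays bounded at 0. *)
Lemma fejer_sum_near N x : x \in `[0, pi] ->
  `|N%:R ^+ 2 * fejer (N%:R * x) - fejer_sum N x| <= 3.
Proof.
rewrite in_itv /= => /andP[x0 xpi].
move: x0; rewrite le_eqVlt => /predU1P[<-|x0].
  by rewrite mulr0 fejer_sum0 /fejer eqxx mulr1 subrr normr0.
have H1 := fejer_sqr (N%:R * x); have H2 := fejer_sumE N x.
set c := 1 - cos x in H2 *; set y := 1 - cos (N%:R * x) in H1 H2 *.
have y2 : 0 <= y <= 2.
  by have := cos_le1 (N%:R * x); have := cos_geN1 (N%:R * x); rewrite /y => ? ?; apply/andP; split; lra.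
have c0 : 0 < c.
  rewrite subr_gt0; have : cos x < cos 0.
    by rewrite ltr_cos // in_itv /= ?lexx ?(ltW pi0) // (ltW x0).
  by rewrite cos0.
have x2 : 0 < x ^+ 2 by exact: exprn_gt0.
have -> : N%:R ^+ 2 * fejer (N%:R * x) - fejer_sum N x = y * (2 / x ^+ 2 - c^-1).
  have -> : fejer_sum N x = y / c by rewrite -H2 mulfK // gt_eqF.
  have -> : N%:R ^+ 2 * fejer (N%:R * x) = 2 * y / x ^+ 2.
    by rewrite -H1; field; rewrite gt_eqF.
  by field; rewrite !gt_eqF.
case/andP: y2 => y0 y2; rewrite normrM (ger0_norm y0).
suff B : `|2 / x ^+ 2 - c^-1| <= 3 / 2.
  by apply: (@le_trans _ _ (2 * (3 / 2))); [rewrite ler_pM|lra].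
have T1 := cos_ge_taylor2 x; have T2 := cos_le_taylor4 x; rewrite /cos_taylor in T2.
have x4 : x ^+ 4 = (x ^+ 2) ^+ 2 by rewrite -exprM.
(* Near 0 the Taylor bounds apply; beyond 2 > pi/2 the cosine is negative. *)
have [xle2|xgt2] := leP x 2.
  have x24 : x ^+ 2 <= 4.
    by rewrite (_ : 4 = 2 ^+ 2); [rewrite lerXn2r ?nnegrE // ltW|ring].
  have cx : x ^+ 2 / 3 <= c by rewrite /c; nra.
  have -> : 2 / x ^+ 2 - c^-1 = (2 * c - x ^+ 2) / (x ^+ 2 * c).
    by field; rewrite !gt_eqF.
  have d0 : 0 < x ^+ 2 * c by exact: mulr_gt0.
  have dV : 0 <= (x ^+ 2 * c)^-1 by rewrite invr_ge0 ltW.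
  rewrite normrM (ger0_norm dV) ler_pdivrMr //.
  by rewrite ler_norml; apply/andP; split; rewrite /c; nra.
have cge1 : 1 <= c.
  rewrite /c; suff : cos x <= 0 by lra.
  have : cos x < cos (pi / 2).
    rewrite ltr_cos ?in_itv /= ?(ltW x0) //.
      by apply: lt_trans xgt2; exact: pihalf_lt2.
    by apply/andP; split; [rewrite divr_ge0 // ltW|rewrite ler_pdivrMr //; lra].
  by rewrite cos_pihalf => /ltW.
have x2ge : 4 <= x ^+ 2.
  by rewrite (_ : 4 = 2 ^+ 2); [rewrite lerXn2r ?nnegrE // ltW|ring].
have i1 : 0 < c^-1 <= 1 by rewrite invr_gt0 c0 invf_le1.
have i2 : 0 < 2 / x ^+ 2 <= 1 / 2.
  by rewrite divr_gt0 //= ler_pdivrMr //; lra.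
case/andP: i1 => ? ?; case/andP: i2 => ? ?.
by rewrite ler_norml; apply/andP; split; lra.
Qed.

Let fejer_primitive_Npi N : `|N.+1%:R * Psi (N.+1%:R * pi) - N.+1%:R * pi| <= 3 * pi.
Proof.
set n : R := N.+1%:R.
have dF (x : R) : is_derive x (1 : R) (fun x => n * Psi (n * x)) (n ^+ 2 * fejer (n * x)).
  have -> : n ^+ 2 * fejer (n * x) = n * (fejer (n * x) * (n * 1 + x * 0)) + Psi (n * x) * 0.
    by ring.
  exact: (is_derive_fun_mul (is_derive_fun_cst n x) (is_derive_fejer_primitive_comp
    (is_derive_fun_mul (is_derive_fun_cst n x) (is_derive_fun_id x)))).
have cf : continuous (fun x => n ^+ 2 * fejer (n * x)).
  apply: continuous_fun_mul; first exact: continuous_fun_cst.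
  move=> x; apply: continuous_comp; last exact: continuous_fejer.
  have : continuous (fun x : R => n * x) by continuity.
  exact.
have := segment_FTC pi0 cf dF; rewrite mulr0 Psi0 mulr0 subr0 => <-.
rewrite -(fejer_sum_integral N.+1).
have cs : continuous (fejer_sum N.+1) := @continuous_fejer_sum N.+1.
have i1 := continuous_segment_integrable 0 pi cf.
have i2 := continuous_segment_integrable 0 pi cs.
rewrite -RintegralB //.
have cd : continuous (fun x => n ^+ 2 * fejer (n * x) - fejer_sum N.+1 x).
  by apply: continuous_fun_add => //; exact: continuous_fun_opp.
apply: (le_trans (le_normr_Rintegral _ (continuous_segment_integrable 0 pi cd))) => //.
have -> : 3 * pi = \int[mu]_(x in `[0, pi]) (3 : R).
  by rewrite Rintegral_cst // measure_0pi.
apply: le_Rintegral => //.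
- have := continuous_segment_integrable 0 pi cd.
  by move/integrable_abse.
- by apply: continuous_segment_integrable; exact: continuous_fun_cst.
- by move=> x xpi; exact: fejer_sum_near.
Qed.

(** The primitive increases to pi: it is pi + O(1/N) at the points N pi. *)
Lemma fejer_primitive_le_pi x : Psi x <= pi.
Proof.
rewrite leNgt; apply/negP => xpi.
pose e := Psi x - pi; have e0 : 0 < e by rewrite subr_gt0.
pose y := `|x| / pi + 3 * pi / e.
have y0 : 0 <= y by rewrite addr_ge0 // !divr_ge0 // ?mulr_ge0 // ltW.
pose N := Num.bound y.
have Ny : y < N.+1%:R by apply: lt_trans (archi_boundP y0) _; rewrite ltr_nat.
have N0 : 0 < N.+1%:R :> R by [].
have H := fejer_primitive_Npi N.
have xN : x <= N.+1%:R * pi.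
  apply: le_trans (ler_norm x) _; rewrite -ler_pdivrMr //.
  apply: le_trans (ltW Ny) => //; rewrite /y lerDl.
  by rewrite divr_ge0 // ?mulr_ge0 // ltW.
have eN : 3 * pi < N.+1%:R * e.
  rewrite -ltr_pdivrMr //; apply: le_lt_trans Ny.
  by rewrite /y lerDr divr_ge0 // ltW.
have PN := fejer_primitive_ndecr xN.
have : N.+1%:R * Psi x <= N.+1%:R * Psi (N.+1%:R * pi) by rewrite ler_wpM2l // ltW.
have := ler_norm (N.+1%:R * Psi (N.+1%:R * pi) - N.+1%:R * pi).
by rewrite /e in eN; lra.
Qed.

Lemma fejer_primitive_ge x : 0 < x -> pi - 4 / x <= Psi x.
Proof.
move=> x0; rewrite leNgt; apply/negP => xpi.
pose e := pi - 4 / x - Psi x; have e0 : 0 < e by rewrite subr_gt0.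
pose y := x / pi + 3 * pi / e.
have y0 : 0 <= y by rewrite addr_ge0 // !divr_ge0 // ?mulr_ge0 // ltW.
pose N := Num.bound y.
have Ny : y < N.+1%:R by apply: lt_trans (archi_boundP y0) _; rewrite ltr_nat.
have N0 : 0 < N.+1%:R :> R by [].
have H := fejer_primitive_Npi N.
have xN : x <= N.+1%:R * pi.
  rewrite -ler_pdivrMr //.
  apply: le_trans (ltW Ny) => //; rewrite /y lerDl.
  by rewrite divr_ge0 // ?mulr_ge0 // ltW.
have eN : 3 * pi < N.+1%:R * e.
  rewrite -ltr_pdivrMr //; apply: le_lt_trans Ny.
  by rewrite /y lerDr divr_ge0 // ltW.
have PN := fejer_primitive_tail x0 xN.
have z0 : 0 < 4 / (N.+1%:R * pi) :> R by rewrite divr_gt0 // mulr_gt0.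
have : N.+1%:R * Psi (N.+1%:R * pi) <= N.+1%:R * (Psi x + 4 / x).
  rewrite ler_wpM2l //; move: (4 / x) (4 / (N.+1%:R * pi)) PN z0 => u v PN z0.
  by lra.
have := ler_norm (- (N.+1%:R * Psi (N.+1%:R * pi) - N.+1%:R * pi)).
rewrite normrN; rewrite /e in eN; move: (4 / x) eN => u eN.
by lra.
Qed.

End FejerPrimitive.

(** * Dominated convergence and the Gaussian integral *)

Section DominatedRintegral.
Context (R : realType).
Local Notation mu := (@lebesgue_measure R).
Implicit Types (D : set (measurableTypeR R)).

Lemma Rintegral_dominated_le D (f g : R -> R) : measurable D ->
  measurable_fun D f -> mu.-integrable D (EFin \o g) ->
  (forall x, D x -> `|f x| <= g x) ->
  `|\int[mu]_(x in D) f x| <= \int[mu]_(x in D) g x.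
Proof.
move=> mD mf ig fg.
have intf : mu.-integrable D (EFin \o f).
  apply: (le_integrable _ _ _ ig) => //; first exact/measurable_EFinP.
  by move=> x Dx /=; rewrite lee_fin (le_trans (fg x Dx)) // ler_norm.
apply: (le_trans (le_normr_Rintegral _ intf)) => //.
by apply: le_Rintegral => //; exact: integrable_norm.
Qed.

Lemma Rintegral_dominated_cvg D (f_ : nat -> R -> R) (f g : R -> R) :
  measurable D ->
  (\forall n \near \oo, measurable_fun D (f_ n) /\
     forall x, D x -> `|f_ n x| <= g x) ->
  mu.-integrable D (EFin \o g) ->
  (forall x, D x -> f_ n x @[n --> \oo] --> f x) ->
  \int[mu]_(x in D) f_ n x @[n --> \oo] --> \int[mu]_(x in D) f x.
Proof.
move=> mD [N _ HN] ig fcvg.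
rewrite -(cvg_shiftn N) /=.
have mf n : measurable_fun D (f_ (n + N)).
  by have [] := HN (n + N)%N (leq_addl _ _).
have fg n x : D x -> `|f_ (n + N) x| <= g x.
  by have [_] := HN (n + N)%N (leq_addl _ _); apply.
have mf' : measurable_fun D f.
  apply: (@measurable_fun_cvg _ _ _ D (fun n => f_ (n + N)%N)) => // x Dx.
  by rewrite (cvg_shiftn N (f_ ^~ x)); exact: fcvg.
have [intf _ cvgf] : [/\ mu.-integrable D (EFin \o f),
    [sequence \int[mu]_(x in D) `|(f_ (n + N) x)%:E - (f x)%:E|]_n @ \oo --> 0 &
    [sequence \int[mu]_(x in D) (f_ (n + N) x)%:E]_n @ \oo -->
      \int[mu]_(x in D) (f x)%:E]%E.
  apply: (@dominated_convergence _ _ R mu D mD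
    (fun n x => (f_ (n + N)%N x)%:E) (EFin \o f) (EFin \o g)) => //.
  - by move=> n; exact/measurable_EFinP.
  - exact/measurable_EFinP.
  - apply: aeW => x Dx; apply: cvg_EFin; first by near=> n.
    by rewrite (cvg_shiftn N (f_ ^~ x)); exact: fcvg.
  - by apply: aeW => x n Dx; rewrite /= lee_fin fg.
have fin : (\int[mu]_(x in D) (f x)%:E)%E \is a fin_num by exact: integrable_fin_num.
by move: cvgf; rewrite -(fineK fin) => /fine_cvg.
Unshelve. all: by end_near. Qed.

End DominatedRintegral.

Section GaussHalfLine.
Context (R : realType).
Local Notation mu := (@lebesgue_measure R).

Lemma Rintegral_gauss_half :
  \int[mu]_(s in `[0, +oo[) expR (- s ^+ 2 / 2) = Num.sqrt (2 * pi) / 2 :> R.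
Proof.
pose f (s : R) := expR (- s ^+ 2 / 2).
have peak0 : 0 < normal_peak (1 : R) by apply: normal_peak_gt0; rewrite oner_eq0.
have H : (\int[mu]_x (f x)%:E = (normal_peak 1)^-1%:E)%E.
  have N : (\int[mu]_x (normal_pdf 0 1 x)%:E = 1)%E := integral_normal_pdf 0 1.
  have fE x : f x = (normal_peak 1)^-1 * normal_pdf 0 1 x.
    rewrite normal_pdfE ?oner_eq0 //= mulrA mulVf ?gt_eqF // mul1r.
    by rewrite /normal_fun subr0 expr1n /f mulr2n.
  under eq_integral do rewrite fE EFinM.
  by rewrite integralZl //= ?N ?mule1 //; exact: integrable_normal_pdf.
have c : continuous f by rewrite /f; continuity.
rewrite ge0_symfun_integralT // in H; last 2 first.
- by move=> x; exact: expR_ge0.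
- by move=> x /=; rewrite /f sqrrN.
rewrite (_ : [set x | _] = `[0, +oo[%classic) in H; last first.
  by apply/seteqP; split => x /=; rewrite in_itv /= andbT.
rewrite /normal_peak invrK expr1n mul1r -[pi *+ 2]mulr_natl in H.
rewrite /Rintegral -/f; move: H; case: (\int[mu]_(x in _) _)%E => [r||] //=.
- by rewrite -EFinM => -[<-]; field.
- by rewrite mulr_infty gtr0_sg // mul1e.
- by rewrite mulr_infty gtr0_sg // mul1e.
Qed.

End GaussHalfLine.

(** * Smoothed indicators of intervals *)

Section SmoothedIndicator.
Context (R : realType).
Local Notation Psi := (@fejer_primitive R).

(** The convolution of the indicator of [a, b] with the kernel of width 1/T, of
    total mass 1. *)
Definition smoothed_indicator (a b T z : R) : R :=
  (Psi (T * (z - a)) - Psi (T * (z - b))) / (2 * pi).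

Let pi1 : 1 < pi :> R. Proof. by apply: lt_le_trans (pi_ge2 R); rewrite ltr1n. Qed.

Lemma fejer_primitive_geNpi (x : R) : - pi <= Psi x.
Proof. by rewrite -[x]opprK fejer_primitive_odd lerN2 fejer_primitive_le_pi. Qed.

Lemma smoothed_indicator_itv (a b T z : R) : a <= b -> 0 < T ->
  0 <= smoothed_indicator a b T z <= 1.
Proof.
move=> ab T0; rewrite /smoothed_indicator.
have p0 : 0 < 2 * pi :> R by rewrite mulr_gt0 // (lt_trans ltr01).
rewrite ler_pdivrMr // divr_ge0 ?(ltW p0) //=.
  have := fejer_primitive_le_pi (T * (z - a)).
  by have := fejer_primitive_geNpi (T * (z - b)); lra.
rewrite subr_ge0; apply: fejer_primitive_ndecr.
by rewrite ler_wpM2l ?(ltW T0) // lerD2l lerN2.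
Qed.

Let weight (z : R) := fejer z + fejer (z - pi).

Let inv_sqr_le_weight (c d z : R) : 0 < d -> d <= `|z - c| ->
  1 / (z - c) ^+ 2 <= (2 + (2 * c ^+ 2 + pi ^+ 2) / d ^+ 2) * weight z.
Proof.
move=> d0 dz; have p0 : 0 < (pi : R) ^+ 2 by rewrite exprn_gt0 // (lt_trans ltr01).
have d2 : 0 < d ^+ 2 by exact: exprn_gt0.
have dz2 : d ^+ 2 <= (z - c) ^+ 2.
  by rewrite -[leRHS]real_normK ?num_real // lerXn2r // nnegrE ltW.
have zc0 : 0 < (z - c) ^+ 2 by exact: lt_le_trans dz2.
set k := (2 * c ^+ 2 + pi ^+ 2) / d ^+ 2.
have c2 := sqr_ge0 c.
have k0 : 0 <= k by rewrite divr_ge0 //; lra.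
have kd : k * d ^+ 2 = 2 * c ^+ 2 + pi ^+ 2 by rewrite mulfVK // gt_eqF.
have z2 := sqr_ge0 z; have zp : 0 < z ^+ 2 + pi ^+ 2 by lra.
apply: (@le_trans _ _ ((2 + k) * (2 / (z ^+ 2 + pi ^+ 2)))); last first.
  by rewrite ler_wpM2l ?fejer_sum_ge // addr_ge0.
rewrite ler_pdivrMr //.
have -> : (2 + k) * (2 / (z ^+ 2 + pi ^+ 2)) * (z - c) ^+ 2 =
    2 * (2 + k) * (z - c) ^+ 2 / (z ^+ 2 + pi ^+ 2) by ring.
rewrite ler_pdivlMr // mul1r.
have s : 0 <= (z - 2 * c) ^+ 2 by exact: sqr_ge0.
have : k * d ^+ 2 <= k * (z - c) ^+ 2 by rewrite ler_wpM2l.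
have : 0 <= (2 + k) * (z - c) ^+ 2 by rewrite mulr_ge0 ?addr_ge0 // ltW.
by rewrite kd; lra.
Qed.

(** Outside [a, b], at distance x from the nearer and y from the farther end, the
    smoothed indicator is the mass of the kernel between T x and T y. *)
Let tail_le (x y T : R) : 0 < x -> x <= y -> 0 < T ->
  (Psi (T * y) - Psi (T * x)) / (2 * pi) <= (y - x) / T * (1 / x ^+ 2).
Proof.
move=> x0 xy T0; have y0 : 0 < y by exact: lt_le_trans xy.
have Tx0 : 0 < T * x by exact: mulr_gt0.
have H := fejer_primitive_tail Tx0 (ler_wpM2l (ltW T0) xy).
have p0 : 0 < 2 * pi :> R by rewrite mulr_gt0 // (lt_trans ltr01).
rewrite ler_pdivrMr //; apply: (le_trans H).
have -> : 4 / (T * x) - 4 / (T * y) = (y - x) / T * (1 / (x * y)) * 4.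
  by field; rewrite !gt_eqF.
have yxT : 0 <= (y - x) / T by rewrite divr_ge0 ?subr_ge0 // ltW.
apply: ler_pM => //; last by have := pi_ge2 R; lra.
  by rewrite mulr_ge0 // divr_ge0 // mulr_ge0 // ltW.
rewrite ler_wpM2l // !div1r lef_pV2 ?posrE ?exprn_gt0 ?mulr_gt0 //.
by rewrite expr2 ler_wpM2l // ltW.
Qed.

(** Within distance d of an end the error is at most 1 and is paid for by a kernel
    of width d at that end.  Elsewhere it is O(1/T) and decays like the inverse
    square of z, which the two translates at scale 1 dominate. *)
Lemma smoothed_indicator_error (a b d : R) : a <= b -> 0 < d ->
  exists2 C : R, 0 <= C & forall (X : set R) (T z : R), 0 < T ->
    `]a, b[%classic `<=` X -> X `<=` `[a, b]%classic ->
    `|\1_X z - smoothed_indicator a b T z| <=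
      2 * fejer (d^-1 * (z - a)) + 2 * fejer (d^-1 * (z - b)) +
      C / T * (fejer (1 * (z - 0)) + fejer (1 * (z - pi))).
Proof.
move=> ab d0.
pose K (c : R) := 2 + (2 * c ^+ 2 + pi ^+ 2) / d ^+ 2.
pose L := (`|a| + `|b|) ^+ 2 + pi ^+ 2.
have K0 c : 0 <= K c.
  rewrite /K; apply: addr_ge0 => //; apply: divr_ge0; last exact: sqr_ge0.
  by rewrite addr_ge0 ?sqr_ge0 // mulr_ge0 // sqr_ge0.
have L0 : 0 <= L by rewrite addr_ge0 ?sqr_ge0.
have ba0 : 0 <= b - a by rewrite subr_ge0.
pose Ca := 2 / d * L; pose Cb := (b - a) * K a; pose Cc := (b - a) * K b.
have Ca0 : 0 <= Ca by rewrite mulr_ge0 // divr_ge0 // ltW.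
have Cb0 : 0 <= Cb by rewrite mulr_ge0.
have Cc0 : 0 <= Cc by rewrite mulr_ge0.
exists (Ca + Cb + Cc); first by rewrite !addr_ge0.
move=> X T z T0 aX Xb; rewrite !mul1r subr0 -/(weight z).
have w0 : 0 <= weight z by rewrite addr_ge0 // fejer_ge0.
have Fa := fejer_ge0 (d^-1 * (z - a)); have Fb := fejer_ge0 (d^-1 * (z - b)).
have split_w : (Ca + Cb + Cc) / T * weight z =
  Ca / T * weight z + Cb / T * weight z + Cc / T * weight z by ring.
have Wa : 0 <= Ca / T * weight z by rewrite !mulr_ge0 // invr_ge0 ltW.
have Wb : 0 <= Cb / T * weight z by rewrite !mulr_ge0 // invr_ge0 ltW.
have Wc : 0 <= Cc / T * weight z by rewrite !mulr_ge0 // invr_ge0 ltW.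
rewrite split_w.
have /andP[H0 H1] := smoothed_indicator_itv z ab T0.
set H := smoothed_indicator a b T z in H0 H1 *.
have i01 : 0 <= (\1_X z : R) <= 1 by rewrite indicE ler0n lern1 leq_b1.
case/andP: i01 => i0 i1.
have near_end c : `|z - c| <= d -> 1 <= 2 * fejer (d^-1 * (z - c)).
  move=> zc; have := fejer_ge_quadratic (d^-1 * (z - c)).
  have : (d^-1 * (z - c)) ^+ 2 <= 1.
    rewrite -real_normK ?num_real // normrM (ger0_norm (x := d^-1)) ?invr_ge0 ?(ltW d0) //.
    by rewrite exprn_ile1 // ?mulr_ge0 ?invr_ge0 ?(ltW d0) // ler_pdivrMl // mulr1.
  by lra.
have le1 : `|\1_X z - H| <= 1 by rewrite ler_norml; apply/andP; split; lra.
have [za|za] := leP `|z - a| d; first by have := near_end a za; lra.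
have [zb|zb] := leP `|z - b| d; first by have := near_end b zb; lra.
have [zlta|zgea] := ltP z a.
  have i : \1_X z = 0 :> R.
    rewrite indicE memNset // => /Xb /=; rewrite in_itv /= => /andP[az _].
    by move: (lt_le_trans zlta az); rewrite ltxx.
  rewrite i sub0r normrN ger0_norm //.
  suff : H <= Cb / T * weight z by lra.
  have -> : H = (Psi (T * (b - z)) - Psi (T * (a - z))) / (2 * pi).
    rewrite /H /smoothed_indicator -(opprB a z) -(opprB b z) !mulrN.
    by rewrite !fejer_primitive_odd; congr (_ / _); ring.
  apply: (le_trans (tail_le _ _ T0)); rewrite ?subr_gt0 ?lerD2r //.
  have -> : b - z - (a - z) = b - a by ring.
  rewrite (_ : (a - z) ^+ 2 = (z - a) ^+ 2); last by ring.
  have -> : Cb / T * weight z = (b - a) / T * (K a * weight z) by rewrite /Cb; ring.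
  by rewrite ler_wpM2l ?divr_ge0 ?(ltW T0) // inv_sqr_le_weight // ltW.
have [zgtb|zleb] := ltP b z.
  have i : \1_X z = 0 :> R.
    rewrite indicE memNset // => /Xb /=; rewrite in_itv /= => /andP[_ bz].
    by move: (lt_le_trans zgtb bz); rewrite ltxx.
  rewrite i sub0r normrN ger0_norm //.
  suff : H <= Cc / T * weight z by lra.
  apply: (le_trans (tail_le _ _ T0)); rewrite ?subr_gt0 ?lerD2l ?lerN2 //.
  have -> : z - a - (z - b) = b - a by ring.
  have -> : Cc / T * weight z = (b - a) / T * (K b * weight z) by rewrite /Cc; ring.
  by rewrite ler_wpM2l ?divr_ge0 ?(ltW T0) // inv_sqr_le_weight // ltW.
have za' : d < z - a by rewrite -(ger0_norm (x := z - a)) // subr_ge0.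
have zb' : d < b - z by rewrite distrC ger0_norm ?subr_ge0 // in zb.
have i : \1_X z = 1 :> R.
  rewrite indicE mem_set //; apply: aX; rewrite /= in_itv /=.
  by apply/andP; split; lra.
rewrite i ger0_norm ?subr_ge0 //.
suff : 1 - H <= Ca / T * weight z by lra.
have pp : 0 < 2 * pi :> R by rewrite mulr_gt0 // (lt_trans ltr01).
have Td0 : 0 < T * d by exact: mulr_gt0.
have tail c : d < c -> pi - Psi (T * c) <= 4 / (T * d).
  move=> dc; have Tc0 : 0 < T * c by rewrite mulr_gt0 // (lt_trans d0).
  have := fejer_primitive_ge Tc0.
  have : 4 / (T * c) <= 4 / (T * d).
    by rewrite ler_wpM2l // lef_pV2 ?posrE // ler_wpM2l ?(ltW T0) // ltW.
  by move: (4 / _) (4 / (T * d)) => u v; lra.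
have Ta := tail _ za'; have Tb := tail _ zb'.
have HE : (1 - H) * (2 * pi) = (pi - Psi (T * (z - a))) + (pi - Psi (T * (b - z))).
  rewrite mulrBl mul1r /H /smoothed_indicator mulfVK ?gt_eqF //.
  by rewrite -(opprB z b) mulrN fejer_primitive_odd; ring.
have le1H : 1 - H <= 4 / (T * d).
  have h0 : 0 <= 1 - H by lra.
  have : (1 - H) * 2 <= (1 - H) * (2 * pi) by rewrite ler_wpM2l //; have := pi1; lra.
  rewrite HE; move: (4 / (T * d)) Ta Tb => v Ta Tb; lra.
apply: (le_trans le1H).
have -> : Ca / T * weight z = 4 / (T * d) * (L * weight z / 2).
  by rewrite /Ca; field; rewrite !gt_eqF.
rewrite ler_peMr ?divr_ge0 ?(ltW Td0) // ler_pdivlMr // mul1r.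
have zL : z ^+ 2 + pi ^+ 2 <= L.
  rewrite lerD2r -real_normK ?num_real // lerXn2r ?nnegrE ?addr_ge0 //.
  rewrite ler_norml; have := ler_norm b; have := ler_norm (- a); rewrite normrN.
  have := normr_ge0 a; have := normr_ge0 b => ? ? ? ?.
  by apply/andP; split; lra.
have W0 : 0 < z ^+ 2 + pi ^+ 2 :> R.
  by rewrite ltr_wpDl ?sqr_ge0 // exprn_gt0 // (lt_trans ltr01).
have := fejer_sum_ge z; rewrite -/(weight z) ler_pdivrMr // mulrC => /le_trans; apply.
by rewrite ler_wpM2r.
Qed.

End SmoothedIndicator.

(** * Local limit for intervals *)

Section FejerAverages.
Context (R : realType).
Local Notation mu := (@lebesgue_measure R).
Local Notation mR := (measurableTypeR R).
Context (S : nat -> R -> R) (A : nat -> R).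
Hypothesis cS : forall n, continuous (S n).
Hypothesis A_cvg : A n @[n --> \oo] --> +oo.
Hypothesis char_dominated : forall T : R, 0 < T -> exists M : R,
  \forall n \near \oo, forall s phi : R, 0 <= s <= T * A n ->
    `|char_cos (S n) (s / A n) phi| <= M / (1 + s ^+ 2).
Hypothesis char_limit : forall s u : R, 0 <= s ->
  char_cos (S n) (s / A n) (- (s / A n * u)) @[n --> \oo] --> expR (- s ^+ 2 / 2).

Let measurable_S n : measurable_fun setT (S n).
Proof. exact: continuous_measurable_fun. Qed.

Definition fejer_average n (T y : R) : R :=
  A n * \int[mu]_(x in `[0, 1]) fejer (T * (S n x - y)).

Local Notation J := fejer_average.

Let kernel n (T y : R) (z : mR * mR) : R :=
  2 / T * (1 - z.1 / (T * A n)) * cos (z.1 / A n * S n z.2 + - (z.1 / A n * y)).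

Let measurable_kernel n T y : measurable_fun setT (kernel n T y).
Proof.
have m1 : measurable_fun setT (fun z : mR * mR => (z.1 : R)) by exact: measurable_fst.
have mS : measurable_fun setT (fun z : mR * mR => S n z.2).
  by apply: measurableT_comp; [exact: measurable_S|exact: measurable_snd].
have m1c c : measurable_fun setT (fun z : mR * mR => (z.1 : R) / c).
  exact: measurable_funM.
apply: measurable_funM.
  by apply: measurable_funM => //; exact: measurable_funB.
apply: measurableT_comp; first exact: continuous_measurable_fun (@continuous_cos R).
apply: measurable_funD; first exact: measurable_funM.
by apply: measurableT_comp => //; exact: measurable_funM.
Qed.

Let weight_le n T (s : R) : 0 < T -> 0 < A n -> s \in `[0, T * A n] ->
  `|2 / T * (1 - s / (T * A n))| <= 2 / T.
Proof.
move=> T0 A0; rewrite in_itv /= => /andP[s0 sT].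
have TA0 : 0 < T * A n by exact: mulr_gt0.
have h : 0 <= s / (T * A n) <= 1.
  by rewrite divr_ge0 ?(ltW TA0) //= ler_pdivrMr // mul1r.
case/andP: h => ? ?.
have T2 : 0 <= 2 / T by rewrite divr_ge0 // ltW.
rewrite normrM (ger0_norm T2) ler_piMr //.
by rewrite ler_norml; apply/andP; split; lra.
Qed.

Let kernel_le n T y s x : 0 < T -> 0 < A n -> s \in `[0, T * A n] ->
  x \in `[0, 1] -> `|kernel n T y (s, x)| <= 2 / T.
Proof.
move=> T0 A0 sT _; rewrite normrM.
apply: le_trans (weight_le T0 A0 sT); rewrite ler_piMr //.
by rewrite ler_norml cos_le1 cos_geN1.
Qed.

Let spectral n T y (s : R) : R := \int[mu]_(x in `[0, 1]) kernel n T y (s, x).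

Let continuous_cosS n (t u : R) : continuous (fun x => cos (t * S n x + u)).
Proof.
apply: continuous_fun_cos; apply: continuous_fun_add; last exact: continuous_fun_cst.
by apply: continuous_fun_mul => //; exact: continuous_fun_cst.
Qed.

Let continuous_fejerS n (T y : R) : continuous (fun x => fejer (T * (S n x - y))).
Proof.
apply: continuous_fun_fejer; apply: continuous_fun_mul; first exact: continuous_fun_cst.
by apply: continuous_fun_add => //; exact: continuous_fun_cst.
Qed.

Let spectralE n T y s : spectral n T y s =
  2 / T * (1 - s / (T * A n)) * char_cos (S n) (s / A n) (- (s / A n * y)).
Proof.
rewrite /spectral /kernel /= segment_integralZ //; exact: continuous_cosS.
Qed.

(** Fubini, applied to the Fourier representation of the kernel. *)
Lemma fejer_average_spectral n T y : 0 < T -> 0 < A n ->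
  J n T y = \int[mu]_(s in `[0, +oo[) (spectral n T y \_ `[0, T * A n]) s.
Proof.
move=> T0 A0; rewrite -Rintegral_mkcondr.
rewrite (_ : `[0, +oo[%classic `&` `[0, T * A n]%classic = `[0, T * A n]%classic); last first.
  apply/seteqP; split => s /=; rewrite !in_itv /= andbT; first by case.
  by move=> /andP[s0 sT]; split => //; rewrite s0.
rewrite /spectral (Rintegral_fubini (f := kernel n T y) (M := 2 / T)); last 2 first.
- exact: measurable_kernel.
- by move=> s x; exact: kernel_le.
rewrite /J -segment_integralZ; last exact: continuous_fejerS.
apply: eq_Rintegral => x _; rewrite -fejer_scaled_integral //.
by apply: eq_Rintegral => s _; rewrite /kernel /=; congr (_ * cos _); ring.
Qed.

Let measurable_spectral n T y : 0 < T -> 0 < A n ->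
  measurable_fun (`[0, +oo[%classic : set mR) (spectral n T y \_ `[0, T * A n]).
Proof.
move=> T0 A0; apply: measurable_funTS.
apply: (measurable_section_integral (f := kernel n T y) (M := 2 / T)).
- exact: measurable_kernel.
- by move=> s x; exact: kernel_le.
Qed.

Let spectral_le n T y s M : 0 < T -> 0 < A n ->
  (forall s phi : R, 0 <= s <= T * A n ->
    `|char_cos (S n) (s / A n) phi| <= M / (1 + s ^+ 2)) ->
  `|(spectral n T y \_ `[0, T * A n]) s| <= 2 / T * M / (1 + s ^+ 2).
Proof.
move=> T0 A0 HM; rewrite /patch; case: ifPn => [sT|_].
  rewrite inE /= in sT; rewrite spectralE normrM -[leRHS]mulrA.
  apply: ler_pM => //; first exact: weight_le.
  by apply: HM; move: sT; rewrite in_itv.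
have M0 : 0 <= M.
  have /HM : 0 <= (0 : R) <= T * A n by rewrite lexx mulr_ge0 // ltW.
  by move=> /(_ 0) /(le_trans (normr_ge0 _)); rewrite expr0n addr0 divr1.
rewrite normr0 divr_ge0 ?addr_ge0 ?sqr_ge0 // mulr_ge0 // divr_ge0 // ltW //.
Qed.

Let integrable_bound (c : R) :
  mu.-integrable (`[0, +oo[%classic : set mR) (EFin \o (fun s => c / (1 + s ^+ 2))).
Proof. by apply: (@integrableS _ _ _ mu setT) => //; exact: integrable_oneDsqrV. Qed.

Let A_gt (c : R) : \forall n \near \oo, c < A n.
Proof. by move/cvgryPgt: A_cvg; apply. Qed.

(** The integrand over the half-line tends to (2 / T) e^(-s^2/2) and is dominated
    by a multiple of 1 / (1 + s^2). *)
Lemma fejer_average_cvg T y : 0 < T ->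
  J n T y @[n --> \oo] --> Num.sqrt (2 * pi) / T.
Proof.
move=> T0; have [M HM] := char_dominated T0.
pose f (s : R) := 2 / T * expR (- s ^+ 2 / 2).
have Tn0 : T != 0 by rewrite gt_eqF.
have limit_value : \int[mu]_(s in `[0, +oo[) f s = Num.sqrt (2 * pi) / T.
  rewrite RintegralZl //; last first.
    apply: (le_integrable _ _ _ (integrable_bound 2)) => //.
      apply/measurable_EFinP; apply: measurable_funTS; apply: continuous_measurable_fun.
      by continuity.
    move=> s _ /=; rewrite lee_fin ger0_norm ?expR_ge0 //.
    apply: le_trans (ler_norm _); have s2 := sqr_ge0 s.
    rewrite ler_pdivlMr; last by lra.
    have E1 := expR_ge1Dx (s ^+ 2 / 2).
    have E2 : expR (- s ^+ 2 / 2) * expR (s ^+ 2 / 2) = 1.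
      by rewrite -expRD mulNr addNr expR0.
    by have E3 := expR_gt0 (- s ^+ 2 / 2); nra.
  by rewrite Rintegral_gauss_half; field.
rewrite -limit_value.
have spec : \int[mu]_(s in `[0, +oo[) (spectral n T y \_ `[0, T * A n]) s @[n --> \oo] -->
    \int[mu]_(s in `[0, +oo[) f s.
  apply: (Rintegral_dominated_cvg (g := fun s => 2 / T * M / (1 + s ^+ 2))) => //.
  - near=> n; have A0 : 0 < A n by near: n; exact: A_gt.
    split; first exact: measurable_spectral.
    by move=> s _; apply: spectral_le => //; near: n.
  move=> s /=; rewrite in_itv /= andbT => s0.
  apply: (@cvg_trans _ (2 / T * (1 - s / (T * A n)) *
      char_cos (S n) (s / A n) (- (s / A n * y)) @[n --> \oo])).
    apply: near_eq_cvg; near=> n; rewrite /patch ifT ?spectralE //.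
    rewrite inE /= in_itv /= s0 -ler_pdivrMl //; apply/ltW.
    by near: n; exact: A_gt.
  apply: cvgM (char_limit _ s0).
  rewrite -[X in _ --> X](mulr1 (2 / T)); apply: cvgMr.
  rewrite -[X in _ --> X]subr0; apply: cvgB; first exact: cvg_cst.
  under eq_cvg do rewrite invfM mulrA.
  apply: scaled_cvg0; apply/gtr0_cvgV0 => //.
refine (cvg_trans _ spec); apply: near_eq_cvg; near=> n.
by rewrite fejer_average_spectral //; near: n; exact: A_gt.
Unshelve. all: by end_near. Qed.

Lemma fejer_average_bounded T : 0 < T -> exists B : R,
  \forall n \near \oo, forall y, `|J n T y| <= B.
Proof.
move=> T0; have [M HM] := char_dominated T0.
exists (\int[mu]_(s in `[0, +oo[) (2 / T * M / (1 + s ^+ 2))).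
near=> n => y; have A0 : 0 < A n by near: n; exact: A_gt.
have Hn : forall s phi : R, 0 <= s <= T * A n ->
    `|char_cos (S n) (s / A n) phi| <= M / (1 + s ^+ 2) by near: n.
rewrite fejer_average_spectral //; apply: Rintegral_dominated_le => //.
- exact: measurable_spectral.
- by move=> s _; exact: spectral_le.
Unshelve. all: by end_near. Qed.

Let fejer_scaled_mass (a b T z : R) : a <= b -> 0 < T ->
  \int[mu]_(y in `[a, b]) fejer (T * (z - y)) =
  (fejer_primitive (T * (z - a)) - fejer_primitive (T * (z - b))) / T.
Proof.
rewrite le_eqVlt => /predU1P[->|ab] T0.
  by rewrite set_itv1 Rintegral_set1 subrr mul0r.
have Tn0 : T != 0 by rewrite gt_eqF.
have dF (y : R) : is_derive y (1 : R)
    (fun y => - T^-1 * fejer_primitive (T * (z + - y))) (fejer (T * (z - y))).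
  have -> : fejer (T * (z - y)) =
      - T^-1 * (fejer (T * (z - y)) * (T * (0 + - 1) + (z + - y) * 0)) +
      fejer_primitive (T * (z + - y)) * 0 by field.
  exact: (is_derive_fun_mul (is_derive_fun_cst (- T^-1) y)
    (is_derive_fejer_primitive_comp (is_derive_fun_mul (is_derive_fun_cst T y)
      (is_derive_fun_add (is_derive_fun_cst z y) (is_derive_fun_opp (is_derive_fun_id y)))))).
rewrite (segment_FTC ab _ dF); first by field.
apply: continuous_fun_fejer; by continuity.
Qed.

(** The bound uniform in y allows the limit of the Fejer averages to be integrated
    over y in [a, b]. *)
Lemma smoothed_indicator_average_cvg (a b T : R) : a <= b -> 0 < T ->
  A n * \int[mu]_(x in `[0, 1]) ((fejer_primitive (T * (S n x - a)) -
    fejer_primitive (T * (S n x - b))) / (2 * pi)) @[n --> \oo] -->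
  (Num.sqrt (2 * pi))^-1 * (b - a).
Proof.
move=> ab T0; have [B HB] := fejer_average_bounded T0.
have Tn0 : T != 0 by rewrite gt_eqF.
have pn0 : pi != 0 :> R by rewrite gt_eqF // pi_gt0.
pose f n (z : mR * mR) : R := A n * fejer (T * (S n z.2 - z.1)).
have mf n : measurable_fun setT (f n).
  apply: measurable_funM => //; apply: measurableT_comp.
    by apply: continuous_measurable_fun; exact: continuous_fejer.
  apply: measurable_funM => //; apply: measurable_funB; last exact: measurable_fst.
  by apply: measurableT_comp; [exact: measurable_S|exact: measurable_snd].
have fM n s x : s \in `[a, b] -> x \in `[0, 1] -> `|f n (s, x)| <= `|A n|.
  move=> _ _; rewrite normrM ler_piMr // ger0_norm ?fejer_le1 //.
  exact: fejer_ge0.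
have JE n y : J n T y = \int[mu]_(x in `[0, 1]) f n (y, x).
  by rewrite segment_integralZ //; exact: continuous_fejerS.
have mab : fine (mu `[a, b]%classic) = b - a.
  rewrite lebesgue_measure_itv /= lte_fin; case: ltP => //= ba.
  by apply/eqP; rewrite eq_sym subr_eq0 eq_le ba ab.
have cvgJ : \int[mu]_(y in `[a, b]) J n T y @[n --> \oo] -->
    \int[mu]_(y in `[a, b]) (Num.sqrt (2 * pi) / T).
  apply: (Rintegral_dominated_cvg (g := fun=> B)) => //.
  - near=> n; split; last first.
      have HBn : forall y, `|J n T y| <= B by near: n.
      by move=> y _.
    apply/measurable_restrictT => //.
    rewrite (_ : (fun y => J n T y) = (fun y => \int[mu]_(x in `[0, 1]) f n (y, x))).
      2: by apply/funext => y; rewrite JE.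
    exact: (measurable_section_integral (mf n) (fM n)).
  - by apply: continuous_segment_integrable; exact: continuous_fun_cst.
  - by move=> y _; exact: fejer_average_cvg.
rewrite Rintegral_cst // mab in cvgJ.
have E n : A n * \int[mu]_(x in `[0, 1]) ((fejer_primitive (T * (S n x - a)) -
    fejer_primitive (T * (S n x - b))) / (2 * pi)) =
    T / (2 * pi) * \int[mu]_(y in `[a, b]) J n T y.
  have cP : continuous (fun x => (fejer_primitive (T * (S n x - a)) -
      fejer_primitive (T * (S n x - b))) / T).
    have cz c : continuous (fun x => fejer_primitive (T * (S n x - c))).
      apply: continuous_fun_fejer_primitive; apply: continuous_fun_mul.
        exact: continuous_fun_cst.
      by apply: continuous_fun_add => //; exact: continuous_fun_cst.
    apply: continuous_fun_mul; last exact: continuous_fun_cst.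
    by apply: continuous_fun_add => //; exact: continuous_fun_opp.
  under [in RHS]eq_Rintegral do rewrite JE.
  rewrite (Rintegral_fubini (mf n) (fM n)) /f /=.
  under [in RHS]eq_Rintegral => x _.
    rewrite segment_integralZ; last first.
      by apply: continuous_fun_fejer; continuity.
    rewrite fejer_scaled_mass //.
    over.
  rewrite segment_integralZ // mulrCA; congr (_ * _).
  rewrite -segment_integralZ //; apply: eq_Rintegral => x _.
  move: (fejer_primitive _ - fejer_primitive _) (pi : R) pn0 => u p pn0.
  by field; rewrite Tn0 pn0.
under eq_cvg do rewrite E.
have -> : (Num.sqrt (2 * pi))^-1 * (b - a) =
    T / (2 * pi) * (Num.sqrt (2 * pi) / T * (b - a)).
  have q2 : Num.sqrt (2 * pi) ^+ 2 = 2 * pi :> R.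
    by rewrite sqr_sqrtr // mulr_ge0 // pi_ge0.
  have q0 : Num.sqrt (2 * pi) != 0 :> R.
    by rewrite gt_eqF // sqrtr_gt0 mulr_gt0 // pi_gt0.
  set r := Num.sqrt (2 * pi) in q2 q0 *.
  by rewrite -q2; field; rewrite q0 Tn0.
by apply: cvgMr; exact: cvgJ.
Unshelve. all: by end_near. Qed.

Definition occupation n (X : set R) : R :=
  A n * \int[mu]_(x in `[0, 1]) \1_X (S n x).

Lemma integrable_occupation n (X : set mR) : measurable X ->
  mu.-integrable `[0, 1] (EFin \o (fun x => \1_X (S n x) : R)).
Proof.
move=> mX; apply: measurable_bounded_integrable => //.
- exact: segment_measure_lty.
- apply: measurable_funTS; apply: measurableT_comp; last exact: measurable_S.
  exact: measurable_indic.
exists 1; split; first exact: num_real.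
move=> N N1 x _ /=; apply: le_trans (ltW N1).
by rewrite indicE ger0_norm ?ler0n // lern1 leq_b1.
Qed.

(** The error of smoothing has limit at most 4 r d + 2 r C / T with
    r = sqrt (2 pi).  Here d is chosen first, then T, since C depends on d. *)
Lemma occupation_interval_cvg (a b : R) (X : set mR) : a <= b -> measurable X ->
  `]a, b[%classic `<=` X -> X `<=` `[a, b]%classic ->
  occupation n X @[n --> \oo] --> (Num.sqrt (2 * pi))^-1 * (b - a).
Proof.
move=> ab mX aX Xb; set l := _ * (b - a).
set r : R := Num.sqrt (2 * pi).
have r0 : 0 < r by rewrite sqrtr_gt0 mulr_gt0 // pi_gt0.
apply/cvgrPdist_le => e e0.
pose d := e / (32 * r); have d0 : 0 < d by rewrite divr_gt0 // mulr_gt0.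
have [C C0 HC] := smoothed_indicator_error ab d0.
pose T := 16 * r * (C + 1) / e.
have T0 : 0 < T by rewrite divr_gt0 // !mulr_gt0 //; lra.
have dV0 : 0 < d^-1 by rewrite invr_gt0.
pose E n := 2 * J n d^-1 a + 2 * J n d^-1 b + C / T * (J n 1 0 + J n 1 pi).
have E_cvg : E n @[n --> \oo] --> 2 * (r / d^-1) + 2 * (r / d^-1) + C / T * (r / 1 + r / 1).
  apply: cvgD; first by apply: cvgD; apply: cvgMr; exact: fejer_average_cvg.
  by apply: cvgMr; apply: cvgD; exact: fejer_average_cvg.
have E_lt : 2 * (r / d^-1) + 2 * (r / d^-1) + C / T * (r / 1 + r / 1) < e / 2.
  have -> : 2 * (r / d^-1) + 2 * (r / d^-1) + C / T * (r / 1 + r / 1) =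
      e / 8 + e / 8 * (C / (C + 1)).
    by rewrite /d /T; field; rewrite !gt_eqF //=; lra.
  have : C / (C + 1) <= 1 by rewrite ler_pdivrMr; lra.
  move: (C / _) => u u1.
  have : e / 8 * u <= e / 8 * 1 by rewrite ler_wpM2l //; lra.
  by lra.
have E_small : \forall n \near \oo, E n < e / 2 by exact: (cvgr_lt _ E_cvg).
have H_cvg := smoothed_indicator_average_cvg ab T0.
have H_small : \forall n \near \oo,
    `|l - A n * \int[mu]_(x in `[0, 1]) smoothed_indicator a b T (S n x)| <= e / 2.
  by move/cvgrPdist_le: H_cvg; apply; lra.
near=> n.
have A0 : 0 < A n by near: n; exact: A_gt.
have En : E n < e / 2 by near: n.
have Hn : `|l - A n * \int[mu]_(x in `[0, 1]) smoothed_indicator a b T (S n x)| <= e / 2.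
  by near: n.
pose H := fun x => smoothed_indicator a b T (S n x).
have cpsi c : continuous (fun x => fejer_primitive (T * (S n x - c))).
  apply: continuous_fun_fejer_primitive; apply: continuous_fun_mul.
    exact: continuous_fun_cst.
  by apply: continuous_fun_add => //; exact: continuous_fun_cst.
have cH : continuous H.
  apply: continuous_fun_mul; last exact: continuous_fun_cst.
  by apply: continuous_fun_add => //; exact: continuous_fun_opp.
pose F := fun x => 2 * fejer (d^-1 * (S n x - a)) + 2 * fejer (d^-1 * (S n x - b)) +
      C / T * (fejer (1 * (S n x - 0)) + fejer (1 * (S n x - pi))).
have c1 c t : continuous (fun x => fejer (t * (S n x - c))).
  exact: continuous_fejerS.
have c2 c t (k : R) : continuous (fun x => k * fejer (t * (S n x - c))).
  by apply: continuous_fun_mul => //; exact: continuous_fun_cst.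
have c3 : continuous (fun x => fejer (1 * (S n x - 0)) + fejer (1 * (S n x - pi))).
  exact: continuous_fun_add.
have c4 : continuous (fun x => C / T *
    (fejer (1 * (S n x - 0)) + fejer (1 * (S n x - pi)))).
  by apply: continuous_fun_mul => //; exact: continuous_fun_cst.
have c5 : continuous (fun x => 2 * fejer (d^-1 * (S n x - a)) +
    2 * fejer (d^-1 * (S n x - b))) by exact: continuous_fun_add.
have cF : continuous F by exact: continuous_fun_add.
have EF : A n * \int[mu]_(x in `[0, 1]) F x = E n.
  rewrite segment_integralD // segment_integralD // !segment_integralZ //.
  by rewrite segment_integralD // /E /J; ring.
have diff : `|A n * \int[mu]_(x in `[0, 1]) H x - occupation n X| <= E n.
  rewrite -EF /occupation -mulrBr normrM (gtr0_norm A0) ler_wpM2l ?(ltW A0) //.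
  have iX := integrable_occupation n mX.
  have iH := continuous_segment_integrable 0 1 cH.
  rewrite distrC -RintegralB //.
  apply: Rintegral_dominated_le => //.
  - apply: measurable_funB.
      by have /integrableP[/measurable_EFinP] := iX.
    by have /integrableP[/measurable_EFinP] := iH.
  - exact: continuous_segment_integrable.
  - by move=> x _; exact: HC.
rewrite -(subrK (A n * \int[mu]_(x in `[0, 1]) H x) l) -addrA.
by apply: (le_trans (ler_normD _ _)); move: Hn diff; rewrite -/H; lra.
Unshelve. all: by end_near. Qed.

End FejerAverages.

(** * From intervals to Jordan measurable sets *)

Section JordanSets.
Context (R : realType).
Local Notation mu := (@lebesgue_measure R).
Local Notation mR := (measurableTypeR R).

Lemma lebE (X : set R) : leb X = mu X.
Proof. by []. Qed.

Lemma le_leb (X Y : set R) : X `<=` Y -> (leb X <= leb Y)%E.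
Proof. by move=> XY; exact: (@le_mu_ext _ _ _ (wlength idfun)). Qed.

(** Taking the infimum and the supremum treats all shapes of intervals alike. *)
Lemma bounded_interval_ends (i : interval R) : bounded_set [set` i] ->
  [set` i] !=set0 ->
  exists2 ab : R * R, ab.1 <= ab.2 &
    `]ab.1, ab.2[%classic `<=` [set` i] /\ [set` i] `<=` `[ab.1, ab.2]%classic.
Proof.
move=> [M [_ HM]] [z iz].
have iM x : [set` i] x -> `|x| <= M + 1 by apply: HM; rewrite ltrDl.
have hs : has_sup [set` i].
  split; first by exists z.
  by exists (M + 1) => x /iM; exact: le_trans (ler_norm _).
have hi : has_inf [set` i].
  split; first by exists z.
  by exists (- (M + 1)) => x /iM; rewrite ler_norml => /andP[].
exists (inf [set` i], sup [set` i]) => /=.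
  by apply: (@le_trans _ _ z); [apply: ge_inf; [case: hi|]|apply: ub_le_sup; [case: hs|]].
split=> [x|x ix].
  rewrite /= in_itv /= => /andP[ix xs].
  have [y iy yx] := inf_lt hi.1 ix.
  have [y' iy' xy'] := sup_gt hs.1 xs.
  by apply: (interval_is_interval iy iy'); rewrite (ltW yx) (ltW xy').
have h1 := ge_inf hi.2 ix; have h2 := ub_le_sup hs.2 ix.
by rewrite /= in_itv /= h1 h2.
Qed.

Lemma lebesgue_measure_between (a b : R) (X : set mR) : a <= b -> measurable X ->
  `]a, b[%classic `<=` X -> X `<=` `[a, b]%classic -> mu X = (b - a)%:E.
Proof.
move=> ab mX aX Xb.
have itvE (u v : bool) : mu [set` Interval (BSide u a) (BSide v b)] = (b - a)%:E.
  rewrite lebesgue_measure_itv /= lte_fin; case: ltP => //= ba.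
  by rewrite (_ : b = a) ?subrr //; apply/eqP; rewrite eq_le ba ab.
apply/eqP; rewrite eq_le; apply/andP; split.
  by rewrite -(itvE true false); apply: le_measure; rewrite ?inE.
by rewrite -(itvE false true); apply: le_measure; rewrite ?inE.
Qed.

Section Occupation.
Context (S : nat -> R -> R) (A : nat -> R) (c : R).
Hypothesis cS : forall n, continuous (S n).
Hypothesis A_cvg : A n @[n --> \oo] --> +oo.
Hypothesis c0 : 0 <= c.
Hypothesis interval_cvg : forall (a b : R) (X : set mR), a <= b -> measurable X ->
  `]a, b[%classic `<=` X -> X `<=` `[a, b]%classic ->
  occupation S A n X @[n --> \oo] --> c * (b - a).

Local Notation occ := (occupation S A).

Let equidistributed (X : set R) := [/\ measurable (X : set mR), (mu X < +oo)%E &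
  occ n X @[n --> \oo] --> c * fine (mu X)].

Let occ0 n : occ n set0 = 0.
Proof.
rewrite /occupation (_ : Rintegral _ _ _ = 0) ?mulr0 //.
under eq_Rintegral do rewrite indic0.
by rewrite Rintegral_cst // mul0r.
Qed.

Let equidistributed0 : equidistributed set0.
Proof.
split; rewrite ?measure0 //=.
by under eq_cvg do rewrite occ0; rewrite mulr0; exact: cvg_cst.
Qed.

Let equidistributed_interval (i : interval R) : bounded_set [set` i] ->
  equidistributed [set` i].
Proof.
move=> bi; have [->|i0] := eqVneq [set` i] set0; first exact: equidistributed0.
have [[a b] /= ab [ai ib]] := bounded_interval_ends bi (proj1 (set0P _) i0).
have mi : measurable ([set` i] : set mR) by exact: measurable_itv.
have E := lebesgue_measure_between ab mi ai ib.
by split => //; rewrite E ?ltry //=; exact: interval_cvg.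
Qed.

Let occU n (X Y : set mR) : measurable X -> measurable Y ->
  occ n (X `|` Y) = occ n X + occ n Y - occ n (X `&` Y).
Proof.
move=> mX mY; have mXY : measurable (X `&` Y) by exact: measurableI.
have mU : measurable (X `|` Y) by exact: measurableU.
have H Z := @integrable_occupation R S cS n Z.
rewrite /occupation -mulrDr -mulrBr; congr (_ * _).
apply/eqP; rewrite eq_sym subr_eq eq_sym; apply/eqP.
rewrite -!RintegralD //; [|exact: H..].
apply: eq_Rintegral => x _; rewrite !indicE in_setU in_setI.
by case: (_ \in X); case: (_ \in Y); rewrite ?addr0 ?add0r.
Qed.

Let equidistributedU (X Y : set R) :
  equidistributed X -> equidistributed Y -> equidistributed (X `&` Y) ->
  equidistributed (X `|` Y).
Proof.
move=> [mX fX cX] [mY fY cY] [mXY fXY cXY].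
have fE (Z : set R) : (mu Z < +oo)%E -> mu Z \is a fin_num.
  by move=> fZ; rewrite ge0_fin_numE.
have E : mu (X `|` Y) = (fine (mu X) + fine (mu Y) - fine (mu (X `&` Y)))%:E.
  rewrite measureUfinl // EFinB EFinD !fineK //; exact: fE.
split; [exact: measurableU|by rewrite E ltry|].
under eq_cvg do rewrite occU //.
by rewrite E /= mulrBr mulrDr; apply: cvgB => //; exact: cvgD.
Qed.

Let union (s : seq (interval R)) : set R := [set x | exists2 i, i \in s & x \in i].

(** Inclusion-exclusion on the first interval; its intersection with the union of
    the others is again a union of intervals, of the same number. *)
Let equidistributed_union (s : seq (interval R)) : (forall i, i \in s -> bounded_set [set` i]) ->
  equidistributed (union s).
Proof.
have [k] := ubnP (size s); elim: k s => // k IH [|i s] /= sk bs.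
  rewrite (_ : union [::] = set0); first exact: equidistributed0.
  by apply/seteqP; split => // x [].
have -> : union (i :: s) = [set` i] `|` union s.
  apply/seteqP; split => x.
    by case=> j; rewrite inE => /predU1P[->|js] xj; [left|right; exists j].
  by case=> [xi|[j js xj]]; [exists i; rewrite ?mem_head|exists j; rewrite ?inE ?js ?orbT].
have bi : bounded_set [set` i] by apply: bs; rewrite mem_head.
have bs' j : j \in s -> bounded_set [set` j].
  by move=> js; apply: bs; rewrite inE js orbT.
apply: equidistributedU; [exact: equidistributed_interval|exact: IH|].
have -> : [set` i] `&` union s = union [seq (i `&` j)%O | j <- s].
  apply/seteqP; split => x.
    case=> xi [j js xj]; exists (i `&` j)%O; first exact: map_f.
    by rewrite in_itvI xi.
  case=> _ /mapP[j js ->] xij.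
  by move: xij; rewrite in_itvI => /andP[xi xj]; split => //; exists j.
apply: IH; first by rewrite size_map.
move=> _ /mapP[j js ->]; rewrite set_itvI.
case: bi => M [Mr HM]; exists M; split => // N MN x /= [xi _].
exact: HM.
Qed.

Let elementary_equidistributed (E : set R) : elementary_set E -> equidistributed E.
Proof. by move=> [s [bs ->]]; exact: equidistributed_union. Qed.

Let leb_occupation n (E : set mR) : measurable E ->
  ((A n)%:E * leb [set x : R | (0 <= x <= 1)%R /\ E (S n x)] = (occ n E)%:E)%E.
Proof.
move=> mE; rewrite /occupation EFinM; congr (_ * _)%E.
have iE := integrable_occupation cS n mE.
rewrite fineK; last exact: integrable_fin_num.
rewrite (_ : (fun x => (\1_E (S n x))%:E) = (fun x => (\1_(S n @^-1` E) x)%:E)) //.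
have mSE : measurable (S n @^-1` E : set mR).
  have mS : measurable_fun (setT : set mR) (S n : mR -> mR).
    exact: continuous_measurable_fun.
  by rewrite -[X in measurable X]setTI; exact: mS.
rewrite integral_indic // lebE; congr (mu _).
by apply/seteqP; split => x /=; rewrite in_itv /= => -[].
Qed.

(** The occupation of B lies between those of elementary sets inside and outside
    B.  The measure in the statement is an outer measure, hence monotone even
    where the preimage of B is not Borel. *)
Lemma jordan_occupation_cvg (B : set R) : bounded_jordan_measurable B ->
  ((A n)%:E * leb [set x : R | (0 <= x <= 1)%R /\ B (S n x)])%E @[n --> \oo] -->
    (c%:E * leb B)%E.
Proof.
move=> [[M [_ HM]] inner_outer].
pose V := outer_jordan_content B.
have el0 : elementary_set (set0 : set R).
  by exists [::]; split => //; apply/seteqP; split => // x [].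
have elM : elementary_set (`[- (M + 1), M + 1]%classic : set R).
  exists [:: `[- (M + 1), M + 1]]; split.
    move=> i; rewrite inE => /eqP ->; exists (M + 1); split; first exact: num_real.
    move=> N MN x /=; rewrite in_itv /= => xM; apply: le_trans (ltW MN).
    by rewrite ler_norml.
  apply/seteqP; split => x; first by move=> xM; exists `[- (M + 1), M + 1]; rewrite ?mem_head.
  by case=> i; rewrite inE => /eqP ->.
have BM : B `<=` `[- (M + 1), M + 1]%classic.
  move=> x Bx; rewrite /= in_itv /= -ler_norml; apply: HM => //.
  by rewrite ltrDl.
have outer_le E : elementary_set E -> B `<=` E -> (V <= leb E)%E.
  by move=> eE BE; apply: ereal_inf_lbound; exists E.
have inner_ge E : elementary_set E -> E `<=` B -> (leb E <= V)%E.
  by move=> eE EB; rewrite /V -inner_outer; apply: ereal_sup_ubound; exists E.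
have leb0 : leb (set0 : set R) = 0%E by rewrite lebE measure0.
have V0 : (0 <= V)%E by rewrite -leb0; exact: inner_ge.
have Vfin : V \is a fin_num.
  rewrite ge0_fin_numE //; apply: le_lt_trans (outer_le _ elM BM) _.
  exact: segment_measure_lty.
have fine_leb E : elementary_set E -> leb E = (fine (mu E))%:E.
  by move=> /elementary_equidistributed[_ fE _]; rewrite fineK // ge0_fin_numE.
have [r rV] : exists r, V = r%:E by exists (fine V); rewrite fineK.
have approx d : 0 < d -> exists E1 E2, [/\ elementary_set E1 /\ elementary_set E2,
    E1 `<=` B /\ B `<=` E2, r - d <= fine (mu E1) & fine (mu E2) <= r + d].
  move=> d0.
  have [_ [E1 [e1 E1B] <-]] : exists2 x,
      [set leb E | E in [set E | elementary_set E /\ E `<=` B]] x & ((r - d)%:E < x)%E.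
    by apply: ereal_sup_gt; rewrite -/(inner_jordan_content B) inner_outer -/V rV lte_fin ltrBlDr ltrDl.
  have [_ [E2 [e2 BE2] <-]] : exists2 x,
      [set leb E | E in [set E | elementary_set E /\ B `<=` E]] x & (x < (r + d)%:E)%E.
    by apply: ereal_inf_lt; rewrite -/(outer_jordan_content B) -/V rV lte_fin ltrDl.
  rewrite (fine_leb _ e2) (fine_leb _ e1) !lte_fin => h2 h1.
  by exists E1, E2; split => //; exact: ltW.
have BV : leb B = r%:E.
  apply/eqP; rewrite eq_le; apply/andP; split; apply/lee_addgt0Pr => d d0.
    have [E1 [E2 [[e1 e2] [E1B BE2] _ h2]]] := approx d d0.
    by apply: (le_trans (le_leb BE2)); rewrite (fine_leb _ e2) -EFinD lee_fin.
  have [E1 [E2 [[e1 e2] [E1B BE2] h1 _]]] := approx d d0.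
  rewrite -leeBlDr // -EFinB; apply: le_trans (le_leb E1B).
  by rewrite (fine_leb _ e1) lee_fin.
rewrite BV.
have leb_le1 n : (leb [set x : R | (0 <= x <= 1)%R /\ B (S n x)] < +oo)%E.
  apply: le_lt_trans (segment_measure_lty (0 : R) 1); rewrite -lebE; apply: le_leb.
  by move=> x [x01 _]; rewrite /= in_itv.
have leb_fin n : leb [set x : R | (0 <= x <= 1)%R /\ B (S n x)] \is a fin_num.
  by rewrite ge0_fin_numE // lebE measure_ge0.
pose x n := A n * fine (leb [set x : R | (0 <= x <= 1)%R /\ B (S n x)]).
have xE n : ((A n)%:E * leb [set x : R | (0 <= x <= 1)%R /\ B (S n x)] = (x n)%:E)%E.
  by rewrite /x EFinM fineK.
under eq_cvg do rewrite xE.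
rewrite -EFinM; apply: cvg_EFin; first by near=> n.
apply/cvgrPdist_le => e e0.
pose d := e / (2 * (c + 1)).
have cd0 : 0 < 2 * (c + 1) by rewrite mulr_gt0 // ltr_wpDl.
have d0 : 0 < d by rewrite divr_gt0.
have cd : c * d <= e / 2.
  rewrite /d mulrA ler_pdivrMr //; have : e / 2 * (2 * (c + 1)) = e * c + e by field.
  by move=> ->; rewrite mulrC lerDl ltW.
have [E1 [E2 [[e1 e2] [E1B BE2] h1 h2]]] := approx d d0.
have [m1 _ cvg1] := elementary_equidistributed e1.
have [m2 _ cvg2] := elementary_equidistributed e2.
have e20 : 0 < e / 2 by rewrite divr_gt0.
have near1 : \forall n \near \oo, `|c * fine (mu E1) - occ n E1| <= e / 2.
  by move/cvgrPdist_le: cvg1; apply.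
have near2 : \forall n \near \oo, `|c * fine (mu E2) - occ n E2| <= e / 2.
  by move/cvgrPdist_le: cvg2; apply.
near=> n.
rewrite [X in _ - X](_ : _ = x n) //.
have A0 : 0 < A n by near: n; move/cvgryPgt: A_cvg; apply.
have l1 : occ n E1 <= x n.
  rewrite -lee_fin -xE -leb_occupation //; apply: lee_wpmul2l; first by rewrite lee_fin ltW.
  by apply: le_leb => z [z01 Ez]; split => //; exact: E1B.
have l2 : x n <= occ n E2.
  rewrite -lee_fin -xE -leb_occupation //; apply: lee_wpmul2l; first by rewrite lee_fin ltW.
  by apply: le_leb => z [z01 Ez]; split => //; exact: BE2.
have k1 : `|c * fine (mu E1) - occ n E1| <= e / 2 by near: n.
have k2 : `|c * fine (mu E2) - occ n E2| <= e / 2 by near: n.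
have c1 : c * (r - d) <= c * fine (mu E1) by rewrite ler_wpM2l.
have c2 : c * fine (mu E2) <= c * (r + d) by rewrite ler_wpM2l.
move: k1 k2; rewrite !ler_norml => /andP[? ?] /andP[? ?].
by apply/andP; split; lra.
Unshelve. all: by end_near. Qed.

End Occupation.
End JordanSets.

Theorem theorem2p4 (R : realType) (q : R) (m : nat -> nat) (a : nat -> nat -> R)
  (hq : 1 < q)
  (hm_pos : forall k : nat, (1 <= k)%N -> (0 < m k)%N)
  (hm_lt : forall k : nat, (1 <= k)%N -> (m k < m k.+1)%N)
  (hm_gap : forall k : nat, (1 <= k)%N -> q <= (m k.+1)%:R / (m k)%:R)
  (hA : array_norm a n @[n --> \oo] --> +oo)
  (hd : exists eps : R, [/\ 0 < eps,
    q <= 2 ->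
      (n%:R `^ (1 + eps)) * array_max a n ^+ 3 @[n --> \oo] --> (0 : R) &
    2 < q ->
      (n%:R `^ (1 + eps)) * array_max a n ^+ 4 @[n --> \oo] --> (0 : R)])
  (B : set R) (hB : bounded_jordan_measurable B) :
  ((array_norm a n)%:E
     * leb [set x : R | 0 <= x <= 1 /\ B (trig_sum m a n x)]%R)%E
    @[n --> \oo] --> ((Num.sqrt (2 * pi))^-1%:E * leb B)%E.
Proof.
have [g [g4 gq dg]] := growth_exponent hq hd.
have dominated := trig_sum_char_dominated hq hm_pos hm_gap hA g4 gq dg.
have limit := trig_sum_char_limit hq hm_pos hm_gap hA g4 gq dg.
have cS n := @continuous_trig_sum R m a n.
apply: (jordan_occupation_cvg cS hA) hB; first by rewrite invr_ge0 sqrtr_ge0.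
by move=> u v X; exact: (occupation_interval_cvg cS hA dominated limit).
Qed.
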